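(* Let $r=D+C^T(J-L_A(x))^{-1}C$ be a minimal symmetric descriptor realization with $r(0)=D+C^TJC\succ 0$. Then: \begin{itemize} \item[(lim)] if $\mathfrak{P}_r(n)$ is convex for each positive integer $n$, then $\mathfrak{P}_r(n)$ contains no hidden singularities of $r$ (for each $n$); and \item[(alg)] the algebraic domain of $r$ contains no hidden singularities of $r$; that is, for each $n$, no element of $\mathrm{Domalg}(r,n)$ is a hidden singularity of $r$. \end{itemize}
   Context: Fix a positive integer $g$. $\mathbb{S}_n(\mathbb{R}^g)$ is the set of $g$-tuples $X=(X_1,\dots,X_g)$ of real symmetric $n\times n$ matrices. For a symmetric matrix $Y$, $Y\succ 0$ means positive definite. For $A=(A_1,\dots,A_g)\in\mathbb{S}_d(\mathbb{R}^g)$, $L_A(x)=\sum_{j=1}^g A_jx_j$, where $x=(x_1,\dots,x_g)$ are freely noncommuting variables, evaluated at $X\in\mathbb{S}_n(\mathbb{R}^g)$ by $L_A(X)=\sum_j A_j\otimes X_j$ (Kronecker product). For a $d\times d$ matrix $J$, $J-L_A(X)$ means $J\otimes I_n-L_A(X)$. Symmetric descriptor realization: an expression $r=D+C^T(J-L_A(x))^{-1}C$, where $J$ is a $d\times d$ real matrix with $J=J^T$, $J^2=I$, $A\in\mathbb{S}_d(\mathbb{R}^g)$, $C$ is a real $d\times\ell$ matrix and $D$ is a real $\ell\times\ell$ matrix. Its invertibility set is $\mathfrak{I}_{J-L_A(x)}(n)=\{X\in\mathbb{S}_n(\mathbb{R}^g): J-L_A(X)\text{ is invertible}\}$ (open and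 dense in $\mathbb{S}_n(\mathbb{R}^g)$), and for $X$ in this set $r(X)=D\otimes I_n+(C^T\otimes I_n)(J-L_A(X))^{-1}(C\otimes I_n)$. The realization is minimal if $\{(JA)^wJC\mathtt{h}: w\text{ a word},\ \mathtt{h}\in\mathbb{R}^\ell\}$ spans $\mathbb{R}^d$; here words are elements of the free semigroup with identity on $x_1,\dots,x_g$, $JA=(JA_1,\dots,JA_g)$, and for a word $w=x_{i_1}\cdots x_{i_k}$ and a tuple $M$, $M^w=M_{i_1}\cdots M_{i_k}$ (identity for the empty word). Hidden singularities and limit domain: $\chi\in\mathbb{S}_n(\mathbb{R}^g)\setminus\mathfrak{I}_{J-L_A(x)}(n)$ is a hidden singularity of $r$ if $r(\chi):=\lim_{X\to\chi}r(X)$ exists, the limit being taken through $X\in\mathfrak{I}_{J-L_A(x)}(n)$. $\mathrm{Domlim}(r,n)$ is the union of $\mathfrak{I}_{J-L_A(x)}(n)$ and the set of hidden singularities of $r$ in $\mathbb{S}_n(\mathbb{R}^g)$. Set $\mathfrak{P}_r(n)=\{X\in\mathrm{Domlim}(r,n): r(X)\succ 0\}$. Rational expressions (analytic at $0$) and algebraic domain: rational expressions are defined recursively. Matrix-valued free polynomials $p=\sum_w P_w w$ (finite sums, real $k_1\times k_2$ coefficients, evaluated by $p(X)=\sum_w P_w\otimes X^w$) are rational expressions, as are formal sums and products of rational expressions of compatible matrix sizes, and the formal inverse $s^{-1}$ of a square-matrix-valued rational expression $s$ whose value $s(0)$ at $0$ is invertible (with $s^{-1}(0)=s(0)^{-1}$).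 The formal domain $\mathrm{Domfor}(s,n)\subseteq\mathbb{S}_n(\mathbb{R}^g)$ is the set of $X$ at which every inverse appearing in the construction of $s$ can be evaluated (i.e. the matrix to be inverted is invertible); it is all of $\mathbb{S}_n(\mathbb{R}^g)$ for a polynomial. Two rational expressions $s,t$ are equivalent if $s(X)=t(X)$ for all $n$ and all $X\in\mathrm{Domfor}(s,n)\cap\mathrm{Domfor}(t,n)$. A descriptor realization $r$ is a rational expression with formal domain $\mathfrak{I}_{J-L_A(x)}(n)$. The algebraic domain of $r$ is the sequence $(\mathrm{Domalg}(r,n))_n$, where $\mathrm{Domalg}(r,n)$ is the union of $\mathrm{Domfor}(s,n)$ over all rational expressions $s$ (analytic at $0$) equivalent to $r$. *)

(* Defs.v *)
From mathcomp Require Import all_boot all_order all_algebra finmap.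
From mathcomp Require Import mxtens.
From mathcomp Require Import all_classical all_reals all_analysis.

Set Implicit Arguments.
Unset Strict Implicit.
Unset Printing Implicit Defensive.

Import Order.TTheory GRing.Theory Num.Theory.
Import numFieldNormedType.Exports.

Local Open Scope classical_set_scope.
Local Open Scope ring_scope.

Definition posdef (R : realType) (m : nat) (Y : 'M[R]_m) : Prop :=
  Y^T = Y /\ forall v : 'cV[R]_m, v != 0 -> 0 < (v^T *m Y *m v) 0 0.

(* Tuples of n x n matrices are plain functions, so that they inherit the
   R-module structure of function spaces; being symmetric is a separate set. *)
Definition mxtuple (R : realType) (g n : nat) : Type := 'I_g -> 'M[R]_n.

Definition symtuple (R : realType) (g n : nat) : set (mxtuple R g n) :=
  [set X | forall j, (X j)^T = X j].

(* A word x_{i_1} ... x_{i_k} is the sequence [:: i_1; ...; i_k]. *)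
Definition word_eval (R : realType) (g n : nat) (M : mxtuple R g n)
    (w : seq 'I_g) : 'M[R]_n :=
  \big[mulmx/1%:M]_(i <- w) M i.

Record descriptor (R : realType) (g d l : nat) := Descriptor {
  desJ : 'M[R]_d;
  desA : mxtuple R g d;
  desC : 'M[R]_(d, l);
  desD : 'M[R]_l;
  desJ_sym : desJ^T = desJ;
  desJ_invol : desJ *m desJ = 1%:M;
  desA_sym : symtuple desA
}.

Definition des_pencil (R : realType) (g d l : nat) (r : descriptor R g d l)
    (n : nat) (X : mxtuple R g n) : 'M[R]_(d * n) :=
  desJ r *t 1%:M - \sum_(j < g) desA r j *t X j.

Definition des_dom (R : realType) (g d l : nat) (r : descriptor R g d l)
    (n : nat) : set (mxtuple R g n) :=
  [set X | symtuple X /\ des_pencil r X \in unitmx].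
Arguments des_dom {R g d l} r n _.

(* Meaningful on [des_dom r n] only: [invmx] is the identity on singular
   matrices. *)
Definition des_eval (R : realType) (g d l : nat) (r : descriptor R g d l)
    (n : nat) (X : mxtuple R g n) : 'M[R]_(l * n) :=
  desD r *t 1%:M
  + ((desC r)^T *t 1%:M) *m invmx (des_pencil r X) *m (desC r *t 1%:M).
Arguments des_eval {R g d l} r n X.

(* The value at the zero tuple; J is its own inverse. *)
Definition des_val0 (R : realType) (g d l : nat) (r : descriptor R g d l) :
    'M[R]_l :=
  desD r + (desC r)^T *m desJ r *m desC r.

(* The library's [span] takes a finite sequence, hence the finite sequence [s]
   drawn from the set [S]. *)
Definition spans (R : realType) (d : nat) (S : set 'cV[R]_d) : Prop :=
  forall v : 'cV[R]_d,
    exists2 s : seq 'cV[R]_d, [set` s] `<=` S & v \in span s.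

Definition minimal (R : realType) (g d l : nat) (r : descriptor R g d l) :
    Prop :=
  spans [set v | exists (w : seq 'I_g) (h : 'cV[R]_l),
    v = word_eval (fun j => desJ r *m desA r j) w *m desJ r *m desC r *m h].

(* The tuples approach [X] in the product topology, through [des_dom r n]. *)
Definition des_approach (R : realType) (g d l : nat) (r : descriptor R g d l)
    (n : nat) (X : mxtuple R g n) : set_system (mxtuple R g n) :=
  within (des_dom r n) (nbhs (X : {ptws 'I_g -> 'M[R]_n})).

Definition hidden_sing (R : realType) (g d l : nat) (r : descriptor R g d l)
    (n : nat) : set (mxtuple R g n) :=
  [set X | [/\ symtuple X, ~ des_dom r n X
             & cvg (des_eval r n @ des_approach r X)]].
Arguments hidden_sing {R g d l} r n _.

Definition domlim (R : realType) (g d l : nat) (r : descriptor R g d l)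
    (n : nat) : set (mxtuple R g n) :=
  des_dom r n `|` hidden_sing r n.
Arguments domlim {R g d l} r n _.

Definition des_value (R : realType) (g d l : nat) (r : descriptor R g d l)
    (n : nat) (X : mxtuple R g n) : 'M[R]_(l * n) :=
  if des_pencil r X \in unitmx then des_eval r n X
  else lim (des_eval r n @ des_approach r X).

Definition posset (R : realType) (g d l : nat) (r : descriptor R g d l)
    (n : nat) : set (mxtuple R g n) :=
  [set X | domlim r n X /\ posdef (des_value r X)].
Arguments posset {R g d l} r n _.

(* A k1 x k2 matrix-valued free polynomial sum_w P_w w is the finitely
   supported function w |-> P_w.  [ratexpr] is the raw syntax; the condition
   imposed on formal inverses is [analytic0]. *)
Inductive ratexpr (R : realType) (g : nat) : nat -> nat -> Type :=
| RPoly k1 k2 of {fsfun seq 'I_g -> 'M[R]_(k1, k2) with 0} : ratexpr R g k1 k2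
| RAdd k1 k2 of ratexpr R g k1 k2 & ratexpr R g k1 k2 : ratexpr R g k1 k2
| RMul k1 k2 k3 of ratexpr R g k1 k2 & ratexpr R g k2 k3 : ratexpr R g k1 k3
| RInv k of ratexpr R g k k : ratexpr R g k k.

Fixpoint rat_val0 (R : realType) (g k1 k2 : nat) (s : ratexpr R g k1 k2) :
    'M[R]_(k1, k2) :=
  match s in ratexpr _ _ k1 k2 return 'M[R]_(k1, k2) with
  | RPoly _ _ p => p [::]
  | RAdd _ _ s t => rat_val0 s + rat_val0 t
  | RMul _ _ _ s t => rat_val0 s *m rat_val0 t
  | RInv _ s => invmx (rat_val0 s)
  end.

Fixpoint analytic0 (R : realType) (g k1 k2 : nat) (s : ratexpr R g k1 k2) :
    Prop :=
  match s with
  | RPoly _ _ _ => True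
  | RAdd _ _ s t => analytic0 s /\ analytic0 t
  | RMul _ _ _ s t => analytic0 s /\ analytic0 t
  | RInv _ s => analytic0 s /\ rat_val0 s \in unitmx
  end.

Fixpoint rat_eval (R : realType) (g k1 k2 : nat) (s : ratexpr R g k1 k2)
    (n : nat) (X : mxtuple R g n) : 'M[R]_(k1 * n, k2 * n) :=
  match s in ratexpr _ _ k1 k2 return 'M[R]_(k1 * n, k2 * n) with
  | RPoly _ _ p => \sum_(w <- finsupp p) p w *t word_eval X w
  | RAdd _ _ s t => rat_eval s X + rat_eval t X
  | RMul _ _ _ s t => rat_eval s X *m rat_eval t X
  | RInv _ s => invmx (rat_eval s X)
  end.

Fixpoint rat_evaluable (R : realType) (g k1 k2 : nat) (s : ratexpr R g k1 k2)
    (n : nat) (X : mxtuple R g n) : Prop :=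
  match s with
  | RPoly _ _ _ => True
  | RAdd _ _ s t => rat_evaluable s X /\ rat_evaluable t X
  | RMul _ _ _ s t => rat_evaluable s X /\ rat_evaluable t X
  | RInv _ s => rat_evaluable s X /\ rat_eval s X \in unitmx
  end.

Definition domfor (R : realType) (g k1 k2 : nat) (s : ratexpr R g k1 k2)
    (n : nat) : set (mxtuple R g n) :=
  [set X | symtuple X /\ rat_evaluable s X].
Arguments domfor {R g k1 k2} s n _.

(* [r] enters as the rational expression whose formal domain is [des_dom r]. *)
Definition equiv_des (R : realType) (g d l : nat) (r : descriptor R g d l)
    (s : ratexpr R g l l) : Prop :=
  forall n : nat, (0 < n)%N -> forall X : mxtuple R g n,
    domfor s n X -> des_dom r n X -> rat_eval s X = des_eval r n X.

Definition domalg (R : realType) (g d l : nat) (r : descriptor R g d l)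
    (n : nat) : set (mxtuple R g n) :=
  \bigcup_(s in [set s | analytic0 s /\ equiv_des r s]) domfor s n.
Arguments domalg {R g d l} r n _.

(* Main.v *)
(**
  Algebraic domain. A rational expression s linearizes: on its formal domain it
  equals c (P - L_A'(X))^-1 b for some affine pencil that is invertible there.
  If s is equivalent to r, all the moments C^T (JA)^w J C and
  c (P^-1 A')^w P^-1 b agree (up to D). If q is the characteristic polynomial of
  P^-1 L_A'(X), then q(J L_A(X)) vanishes when compressed by the moments, hence
  vanishes by minimality; as q(1) <> 0, J - L_A(X) is invertible.

  Limits. Let chi be a hidden singularity in the positivity set. For a small
  tuple Y the direct sum chi (+) Y is the midpoint of (1 +- u) chi (+) Y, so
  convexity forces r to have a limit at chi (+) Y. Approach it by coupling
  s chi to Y through an off-diagonal block u s chi, and write L = L_A(s chi),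
  S = (J - L)^-1. A Schur complement expresses r there through
  c (u^2 L S L) c^T, up to higher order, where c depends only on Y and is left
  invertible for a suitable Y, by minimality. Existence of the limit then bounds
  L S L, hence S, uniformly as s -> 1. But on ker (J - L_A(chi)) one has
  (J - L) x = (1 - s) J x, so this kernel is 0.

  In both parts Y is a symmetrized Fock-space tuple: its vertices are the words
  of length at most M, X_j joins w to x_j w, and the entry of the resolvent from
  the empty word to w is, at leading order in the scaling, the moment of w.
*)
Require Import Defs.
From mathcomp Require Import all_boot all_order all_algebra finmap.
From mathcomp Require Import mxtens.
From mathcomp Require Import all_classical all_reals all_analysis.
From mathcomp Require Import ring lra.

Set Implicit Arguments.
Unset Strict Implicit.
Unset Printing Implicit Defensive.

Import Order.TTheory GRing.Theory Num.Theory.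
Import numFieldNormedType.Exports.

Local Open Scope classical_set_scope.
Local Open Scope ring_scope.

(** * Kronecker products *)

Lemma tensmxDl (R : pzRingType) m n p q (A B : 'M[R]_(m, n)) (C : 'M[R]_(p, q)) :
  (A + B) *t C = A *t C + B *t C.
Proof. by apply/matrixP=> i j; rewrite !mxE mulrDl. Qed.

Lemma tensmxDr (R : pzRingType) m n p q (C : 'M[R]_(m, n)) (A B : 'M[R]_(p, q)) :
  C *t (A + B) = C *t A + C *t B.
Proof. by apply/matrixP=> i j; rewrite !mxE mulrDr. Qed.

Lemma tensmxNl (R : pzRingType) m n p q (A : 'M[R]_(m, n)) (C : 'M[R]_(p, q)) :
  (- A) *t C = - (A *t C).
Proof. by apply/matrixP=> i j; rewrite !mxE mulNr. Qed.

Lemma tensmxZr (R : comPzRingType) m n p q (a : R) (A : 'M[R]_(m, n)) (C : 'M[R]_(p, q)) :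
  A *t (a *: C) = a *: (A *t C).
Proof. by apply/matrixP=> i j; rewrite !mxE mulrCA. Qed.

Lemma tensmx_suml (R : pzRingType) m n p q I (s : seq I) (P : pred I) (F : I -> 'M[R]_(m, n))
    (C : 'M[R]_(p, q)) :
  (\sum_(i <- s | P i) F i) *t C = \sum_(i <- s | P i) (F i *t C).
Proof.
by elim/big_rec2: _ => [|i y x _ <-]; rewrite ?tens0mx ?tensmxDl.
Qed.

Lemma tensmx_sumr (R : pzRingType) m n p q I (s : seq I) (P : pred I) (F : I -> 'M[R]_(p, q))
    (C : 'M[R]_(m, n)) :
  C *t (\sum_(i <- s | P i) F i) = \sum_(i <- s | P i) (C *t F i).
Proof.
by elim/big_rec2: _ => [|i y x _ <-]; rewrite ?tensmx0 ?tensmxDr.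
Qed.

Lemma tensmx11 (R : pzRingType) m n : (1%:M : 'M[R]_m) *t (1%:M : 'M[R]_n) = 1%:M.
Proof.
apply/matrixP => i j; case: (mxtens_indexP i) => a b; case: (mxtens_indexP j) => c e.
rewrite tensmxE !mxE (can_eq (@mxtens_indexK _ _)) xpair_eqE.
by rewrite -natrM mulnb.
Qed.

Lemma tensmx_inv (R : comUnitRingType) m n (A : 'M[R]_m) :
  A \in unitmx ->
  A *t (1%:M : 'M[R]_n) \in unitmx /\ invmx (A *t (1%:M : 'M[R]_n)) = invmx A *t 1%:M.
Proof.
move=> uA; have e : (A *t 1%:M) *m (invmx A *t (1%:M : 'M[R]_n)) = 1%:M.
  by rewrite tensmx_mul mulmxV // mulmx1 tensmx11.
have [u _] := mulmx1_unit e; split=> //.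
by rewrite -[RHS](mulKmx u) e mulmx1.
Qed.

Lemma unitmx_inj (F : fieldType) n (A : 'M[F]_n) :
  (forall x : 'cV_n, A *m x = 0 -> x = 0) -> A \in unitmx.
Proof.
move=> h; rewrite -unitmx_tr -row_free_unit; apply: inj_row_free => v e.
by apply: trmx_inj; rewrite trmx0; apply: h; rewrite -[A]trmxK -trmx_mul e trmx0.
Qed.

(** * An entrywise submultiplicative norm *)

Section L1.
Variable R : realFieldType.

Definition l1 m n (A : 'M[R]_(m, n)) : R := \sum_i \sum_j `|A i j|.

Lemma l1_ge0 m n (A : 'M[R]_(m, n)) : 0 <= l1 A.
Proof. by apply: sumr_ge0 => i _; apply: sumr_ge0. Qed.

Lemma l1_entry m n (A : 'M[R]_(m, n)) i j : `|A i j| <= l1 A.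
Proof.
rewrite /l1 (bigD1 i) //= (bigD1 j) //= -addrA lerDl addr_ge0 ?sumr_ge0 //.
by move=> k _; apply: sumr_ge0.
Qed.

Lemma l1_eq0 m n (A : 'M[R]_(m, n)) : l1 A <= 0 -> A = 0.
Proof.
move=> h; apply/matrixP => i j; rewrite mxE; apply/eqP; rewrite -normr_eq0.
by rewrite eq_le normr_ge0 andbT (le_trans (l1_entry A i j)).
Qed.

Lemma l10 m n : l1 (0 : 'M[R]_(m, n)) = 0.
Proof. by rewrite /l1 big1 // => i _; rewrite big1 // => j _; rewrite mxE normr0. Qed.

Lemma l1D m n (A B : 'M[R]_(m, n)) : l1 (A + B) <= l1 A + l1 B.
Proof.
rewrite /l1 -big_split; apply: ler_sum => i _ /=.
by rewrite -big_split; apply: ler_sum => j _ /=; rewrite mxE ler_normD.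
Qed.

Lemma l1Z m n a (A : 'M[R]_(m, n)) : l1 (a *: A) = `|a| * l1 A.
Proof.
rewrite /l1 mulr_sumr; apply: eq_bigr => i _.
by rewrite mulr_sumr; apply: eq_bigr => j _; rewrite mxE normrM.
Qed.

Lemma l1N m n (A : 'M[R]_(m, n)) : l1 (- A) = l1 A.
Proof. by rewrite -scaleN1r l1Z normrN1 mul1r. Qed.

Lemma l1_tr m n (A : 'M[R]_(m, n)) : l1 A^T = l1 A.
Proof.
rewrite /l1 exchange_big; apply: eq_bigr => i _.
by apply: eq_bigr => j _; rewrite mxE.
Qed.

Lemma l1M m n p (A : 'M[R]_(m, n)) (B : 'M[R]_(n, p)) : l1 (A *m B) <= l1 A * l1 B.
Proof.
rewrite {1 2}/l1 mulr_suml; apply: ler_sum => i _.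
have h j : \sum_k `|B j k| <= l1 B.
  by rewrite /l1 (bigD1 j) //= lerDl sumr_ge0 // => k _; apply: sumr_ge0.
apply: (@le_trans _ _ (\sum_k \sum_j `|A i j| * `|B j k|)).
  apply: ler_sum => k _; rewrite mxE; apply: le_trans (ler_norm_sum _ _ _) _.
  by apply: ler_sum => j _; rewrite normrM.
rewrite exchange_big mulr_suml; apply: ler_sum => j _ /=.
by rewrite -mulr_sumr ler_wpM2l.
Qed.

Lemma l1_tens m n p q (A : 'M[R]_(m, n)) (B : 'M[R]_(p, q)) :
  l1 (A *t B) = l1 A * l1 B.
Proof.
rewrite /l1 mulr_sum; apply: eq_bigr => i _.
by rewrite mulr_sum; apply: eq_bigr => j _; rewrite mxE normrM.
Qed.

Lemma l1_le m n (A : 'M[R]_(m, n)) e :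
  (forall i j, `|A i j| <= e) -> l1 A <= (m * n)%:R * e.
Proof.
move=> h; rewrite /l1 mulr_natl mulnC mulrnA -[X in _ <= _ *+ X]card_ord -sumr_const.
apply: ler_sum => i _; rewrite -[X in _ <= _ *+ X]card_ord -sumr_const.
exact: ler_sum.
Qed.

(** A kernel vector of [B + E] satisfies [x = - B^-1 E x], which halves its norm, so it is 0. The
    error estimate comes from the resolvent identity [I - B^-1 = - B^-1 E I], once [l1 I] is at most
    twice [l1 B^-1]. *)
Lemma unitmx_perturb n (B E : 'M[R]_n) :
  B \in unitmx -> l1 E * l1 (invmx B) <= 2^-1 ->
  B + E \in unitmx /\
  l1 (invmx (B + E) - invmx B) <= 2 * l1 (invmx B) ^+ 2 * l1 E.
Proof.
move=> uB hE.
have u : B + E \in unitmx.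
  apply: unitmx_inj => x /eqP; rewrite mulmxDl addr_eq0 => /eqP h.
  have e : x = - (invmx B *m E *m x) by rewrite -mulmxA -mulmxN -h mulKmx.
  have h2 : l1 x <= 2^-1 * l1 x.
    rewrite {1}e l1N (le_trans (l1M _ _)) // ler_wpM2r ?l1_ge0 //.
    by rewrite (le_trans (l1M _ _)) // mulrC.
  by apply: l1_eq0; lra.
split=> //; set I := invmx (B + E).
have e : I - invmx B = - (invmx B *m E *m I).
  have h : (B + E) *m I = 1%:M by rewrite mulmxV.
  rewrite -{1}[invmx B]mulmx1 -h mulmxDl mulmxDr mulKmx //.
  by rewrite opprD addrA subrr add0r mulmxA.
have b : l1 (I - invmx B) <= l1 (invmx B) * l1 E * l1 I.
  by rewrite e l1N (le_trans (l1M _ _)) // ler_wpM2r ?l1_ge0 // l1M.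
have i2 : l1 I <= 2 * l1 (invmx B).
  have := l1D (I - invmx B) (invmx B); rewrite subrK.
  have : l1 (invmx B) * l1 E * l1 I <= 2^-1 * l1 I.
    by rewrite ler_wpM2r ?l1_ge0 // mulrC.
  lra.
apply: le_trans b _.
have -> : 2 * l1 (invmx B) ^+ 2 * l1 E = l1 (invmx B) * l1 E * (2 * l1 (invmx B)).
  by ring.
by rewrite ler_wpM2l // mulr_ge0 ?l1_ge0.
Qed.

(** * One-sided limits at zero with a linear rate *)

Definition small (P : R -> Prop) : Prop :=
  exists2 d, 0 < d & forall t, 0 < t -> t <= d -> P t.

Lemma small_and (P Q : R -> Prop) : small P -> small Q -> small (fun t => P t /\ Q t).
Proof.
move=> [d d0 hP] [e e0 hQ]; exists (Num.min d e); first by rewrite lt_min d0.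
by move=> t t0; rewrite le_min => /andP[td te]; split; [apply: hP | apply: hQ].
Qed.

Lemma small_impl (P Q : R -> Prop) :
  (forall t, 0 < t -> P t -> Q t) -> small P -> small Q.
Proof. by move=> h [d d0 hP]; exists d => // t t0 td; apply: h => //; apply: hP. Qed.

Lemma small_ex (P : R -> Prop) : small P -> exists2 t, 0 < t & P t.
Proof. by move=> [d d0 hP]; exists d => //; apply: hP. Qed.

(* Convergence as t -> 0+ at a linear rate. *)
Definition lim0 m n (f : R -> 'M[R]_(m, n)) (L : 'M[R]_(m, n)) : Prop :=
  exists2 C, 0 <= C & small (fun t => l1 (f t - L) <= C * t).

Lemma lim0_small m n (f : R -> 'M[R]_(m, n)) L e :
  0 < e -> lim0 f L -> small (fun t => l1 (f t - L) <= e).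
Proof.
move=> e0 [C C0 h].
have C1 : 0 < C + 1 by rewrite ltr_wpDl.
have h2 : small (fun t => t <= e / (C + 1)) by exists (e / (C + 1)) => //; rewrite divr_gt0.
apply: small_impl (small_and h h2) => t t0 [h1]; rewrite ler_pdivlMr // => h3.
by apply: le_trans h1 _; nra.
Qed.

Lemma lim0_cst m n (L : 'M[R]_(m, n)) : lim0 (fun=> L) L.
Proof. by exists 0 => //; exists 1 => // t t0 _; rewrite subrr l10 mul0r. Qed.

Lemma lim0_eq m n (f g : R -> 'M[R]_(m, n)) L :
  small (fun t => f t = g t) -> lim0 f L -> lim0 g L.
Proof.
move=> e [C C0 h]; exists C => //.
by apply: small_impl (small_and e h) => t _ [<-].
Qed.

Lemma lim0_scale m n (A : 'M[R]_(m, n)) k : lim0 (fun t => t ^+ k.+1 *: A) 0.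
Proof.
exists (l1 A); first exact: l1_ge0.
exists 1 => // t t0 t1; rewrite subr0 l1Z mulrC ler_wpM2l ?l1_ge0 //.
have t0' := ltW t0.
by rewrite ger0_norm ?exprn_ge0 // exprS ler_piMr // exprn_ile1.
Qed.

Lemma lim0D m n (f g : R -> 'M[R]_(m, n)) L M :
  lim0 f L -> lim0 g M -> lim0 (fun t => f t + g t) (L + M).
Proof.
move=> [C C0 h] [D D0 k]; exists (C + D); first exact: addr_ge0.
apply: small_impl (small_and h k) => t _ [h1 k1].
by rewrite opprD addrACA (le_trans (l1D _ _)) // mulrDl lerD.
Qed.

Lemma lim0N m n (f : R -> 'M[R]_(m, n)) L : lim0 f L -> lim0 (fun t => - f t) (- L).
Proof.
move=> [C C0 h]; exists C => //; apply: small_impl h => t _ h1.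
by rewrite -opprD l1N.
Qed.

Lemma lim0_sum m n I (s : seq I) (F : I -> R -> 'M[R]_(m, n)) (L : I -> 'M[R]_(m, n)) :
  (forall i, lim0 (F i) (L i)) ->
  lim0 (fun t => \sum_(i <- s) F i t) (\sum_(i <- s) L i).
Proof.
move=> h; elim: s => [|i s IH].
  rewrite big_nil; apply: lim0_eq (lim0_cst _); exists 1 => // t _ _.
  by rewrite big_nil.
rewrite big_cons; apply: lim0_eq (lim0D (h i) IH); exists 1 => // t _ _.
by rewrite big_cons.
Qed.

Lemma lim0_tens m n p q (A : 'M[R]_(p, q)) (f : R -> 'M[R]_(m, n)) L :
  lim0 f L -> lim0 (fun t => A *t f t) (A *t L).
Proof.
move=> [C C0 h]; exists (l1 A * C); first by rewrite mulr_ge0 ?l1_ge0.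
apply: small_impl h => t _ h.
have -> : A *t f t - A *t L = A *t (f t - L) by apply/matrixP => i j; rewrite !mxE mulrBr.
by rewrite l1_tens -mulrA ler_wpM2l ?l1_ge0.
Qed.

Lemma lim0M m n p (f : R -> 'M[R]_(m, n)) (g : R -> 'M[R]_(n, p)) L M :
  lim0 f L -> lim0 g M -> lim0 (fun t => f t *m g t) (L *m M).
Proof.
move=> [C C0 h] [D D0 k].
exists (C * (D + l1 M) + l1 L * D).
  by rewrite addr_ge0 ?mulr_ge0 ?l1_ge0 // addr_ge0 ?l1_ge0.
have s1 : small (fun t => t <= 1) by exists 1.
apply: small_impl (small_and (small_and h k) s1) => t t0 [[h1 k1] t1].
have -> : f t *m g t - L *m M = (f t - L) *m g t + L *m (g t - M).
  by rewrite mulmxBl mulmxBr addrA subrK.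
rewrite (le_trans (l1D _ _)) // mulrDl lerD //.
  rewrite (le_trans (l1M _ _)) // mulrAC.
  have gM : l1 (g t) <= D + l1 M.
    rewrite -[g t](subrK M) (le_trans (l1D _ _)) // lerD2r (le_trans k1) //.
    by rewrite ler_piMr.
  by apply: ler_pM; rewrite ?l1_ge0.
by rewrite (le_trans (l1M _ _)) // -mulrA ler_wpM2l // l1_ge0.
Qed.

Lemma lim0V n (f : R -> 'M[R]_n) L :
  L \in unitmx -> lim0 f L ->
  small (fun t => f t \in unitmx) /\ lim0 (fun t => invmx (f t)) (invmx L).
Proof.
move=> uL [C C0 h].
set N := l1 (invmx L); have N0 : 0 <= N by apply: l1_ge0.
have e0 : 0 < (2 * (N + 1))^-1 by rewrite invr_gt0 mulr_gt0 // ltr_wpDl.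
have s1 := lim0_small e0 (ex_intro2 _ _ C C0 h).
have s2 : small (fun t => l1 (f t - L) * N <= 2^-1).
  apply: small_impl s1 => t t0 h1.
  have : (2 * (N + 1))^-1 * N <= 2^-1.
    by rewrite mulrC ler_pdivrMr ?mulr_gt0 ?ltr_wpDl //; lra.
  by apply: le_trans; rewrite ler_wpM2r.
split.
  apply: small_impl s2 => t t0 h1; rewrite -[f t](subrK L) addrC.
  by case: (unitmx_perturb uL h1).
exists (2 * N ^+ 2 * C); first by rewrite !mulr_ge0 ?exprn_ge0.
apply: small_impl (small_and s2 h) => t t0 [h1 h2].
have [_] := unitmx_perturb uL h1; rewrite [L + _]addrC subrK => /le_trans; apply.
by rewrite -[_ * t]mulrA ler_wpM2l // mulr_ge0 ?exprn_ge0.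
Qed.

Lemma lim0_uniq m n (f : R -> 'M[R]_(m, n)) L M : lim0 f L -> lim0 f M -> L = M.
Proof.
move=> h k; apply/eqP; rewrite -subr_eq0; apply/eqP/l1_eq0.
apply/ler_addgt0Pr => e e0; rewrite add0r.
have e2 : 0 < e / 2 by rewrite divr_gt0.
have [t t0 [h1 k1]] := small_ex (small_and (lim0_small e2 h) (lim0_small e2 k)).
have -> : L - M = (f t - M) - (f t - L) by rewrite opprB [RHS]addrC addrA subrK.
rewrite (le_trans (l1D _ _)) // l1N; lra.
Qed.

End L1.

(** * Nonvanishing of determinants along a line *)

Lemma poly_nonroot (R : realFieldType) (p : {poly R}) (a b : R) :
  p != 0 -> a < b -> exists s, [/\ a < s, s < b & p.[s] != 0].
Proof.
move=> p0 ab.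
(* Distinct points, strictly below [b] since the denominators start at 2; the first [size p] of them
   cannot all be roots. *)
pose pt i : R := a + (b - a) / (i.+2)%:R.
have ba : 0 < b - a by rewrite subr_gt0.
have inj : injective pt.
  move=> i j /addrI /(mulfI (lt0r_neq0 ba)) /invr_inj /eqP.
  by rewrite eqr_nat => /eqP [].
case: (boolP (all (root p) (map pt (iota 0 (size p))))) => [h|].
  have u : uniq (map pt (iota 0 (size p))) by rewrite map_inj_uniq ?iota_uniq.
  by have := max_poly_roots p0 h u; rewrite size_map size_iota ltnn.
rewrite -has_predC => /hasP[_ /mapP[i _ ->]] /= r; exists (pt i); split => //.
  by rewrite ltrDl divr_gt0.
by rewrite /pt -ltrBrDl ltr_pdivrMr // ltr_pMr // (ltr_nat R 1).
Qed.

Definition det_line (R : comNzRingType) n (A B : 'M[R]_n) : {poly R} :=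
  \det (map_mx polyC A + 'X *: map_mx polyC B).

Lemma det_lineE (R : comNzRingType) n (A B : 'M[R]_n) s :
  (det_line A B).[s] = \det (A + s *: B).
Proof.
rewrite -[_.[s]]/(horner_eval s _) -det_map_mx; congr (\det _).
by apply/matrixP => i j; rewrite !mxE /= /horner_eval hornerD hornerM hornerX !hornerC.
Qed.

(** * Limits at hidden singularities *)

Lemma finite_uniform_radius (R : realType) (I : finType) (P : I -> R -> Prop) :
  (forall i, exists2 d, 0 < d & P i d) ->
  (forall i d e, P i d -> 0 < e -> e <= d -> P i e) ->
  exists2 d, 0 < d & forall i, P i d.
Proof.
move=> h mono; have [f f0 fP] : exists2 f : I -> R, (forall i, 0 < f i) & forall i, P i (f i).
  have /choice[f fP] : forall i, exists d, 0 < d /\ P i d.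
    by move=> i; have [d d0 dP] := h i; exists d.
  by exists f => i; case: (fP i).
have m0 : 0 < \big[Num.min/1]_i f i.
  exact: lt_bigmin.
exists (\big[Num.min/1]_i f i) => // i; apply: mono (fP i) m0 _.
exact: bigmin_le.
Qed.

(** The filter generated by the [l1]-balls around [X] converges to [X] in the product topology,
    hence contains every neighbourhood of [X]. *)
Lemma nbhs_mxtuple (R : realType) (g n : nat) (X : mxtuple R g n) (U : set (mxtuple R g n)) :
  nbhs (X : {ptws 'I_g -> 'M[R]_n}) U ->
  exists2 d, 0 < d & forall Z, (forall j, l1 (Z j - X j) <= d) -> U Z.
Proof.
move=> UX.
pose B d := [set Z : mxtuple R g n | forall j, l1 (Z j - X j) <= d].
pose G := filter_from [set d : R | 0 < d] B.
have FG : Filter G.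
  apply: filter_from_filter; first by exists 1 => /=.
  move=> d e d0 e0; exists (Num.min d e); first by rewrite /= lt_min d0.
  by move=> Z h; split => j; have := h j; rewrite le_min => /andP[].
have GX : {ptws, G --> (X : {ptws 'I_g -> 'M[R]_n})}.
  (* The product topology is the supremum of the topologies pulled back along the coordinates, so
     each coordinate is treated alone. *)
  apply/cvg_sup => j.
  rewrite cvg_image; last by rewrite eqEsubset; split=> v // _; exists (fun=> v).
  move=> A [P PX PA].
  have [d d0 dP] : exists2 d : R, 0 < d & forall ab : 'I_n * 'I_n,
      ball (X j ab.1 ab.2) d `<=` P ab.1 ab.2.
    apply: (@finite_uniform_radius R ('I_n * 'I_n)%type (fun ab d => ball (X j ab.1 ab.2) d
        `<=` P ab.1 ab.2)).
      by move=> [a b] /=; have /nbhs_ballP[d d0 h] := PX a b; exists d.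
    by move=> [a b] e f /= h f0 fe; apply: subset_trans h; apply: le_ball.
  exists ((fun f : mxtuple R g n => f j) @^-1` A); last first.
    by rewrite eqEsubset; split => [_ [f ? <-] //|M AM]; exists (fun=> M).
  exists (d / 2); first by rewrite /= divr_gt0.
  move=> Z /(_ j) /= h; apply: PA => a b; apply: (dP (a, b)).
  rewrite /ball /= distrC.
  have := l1_entry (Z j - X j) a b; rewrite !mxE => h2.
  by lra.
have [d d0 dU] := GX U UX.
by exists d.
Qed.

Lemma hidden_sing_limit (R : realType) (g d l : nat) (r : descriptor R g d l) (n : nat)
    (X : mxtuple R g n) (e : R) :
  hidden_sing r n X -> 0 < e ->
  exists2 dl, 0 < dl & forall Z, des_dom r n Z -> (forall j, l1 (Z j - X j) <= dl) ->
    l1 (des_eval r n Z - lim (des_eval r n @ des_approach r X)) <= e.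
Proof.
move=> [_ _ cv] e0; set L := lim _.
(* There are [(l * n) * (l * n)] entries; the successor avoids a division by zero when there are
   none. *)
pose e' := e / ((l * n) * (l * n)).+1%:R.
have e'0 : 0 < e' by rewrite divr_gt0.
have NB : nbhs L [set M | forall i j, `|M i j - L i j| < e'].
  exists (fun i j => ball (L i j) e'); first by move=> i j; apply: nbhsx_ballx; exact: e'0.
  move=> M h i j; have := h i j; rewrite /ball /= distrC; exact.
have [dl dl0 h] := nbhs_mxtuple (cv _ NB).
exists dl => // Z Zd ZX; have := h Z ZX Zd => {}h.
apply: (@le_trans _ _ (((l * n) * (l * n))%:R * e')).
  apply: l1_le => i j; rewrite [X in `|X|]mxE [(- L) i j]mxE.
  exact: ltW (h i j).
rewrite /e' mulrCA ler_piMr //; first exact: ltW.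
by rewrite ler_pdivrMr // mul1r ler_nat.
Qed.

(** * Symmetrized Fock-space tuples *)

Section Emb.
Variables (R : realType) (F : finType) (n : nat).

(* The inclusion of the copy of R^n indexed by [x] in the direct sum over [F]. *)
Definition block_emb (x : F) : 'M[R]_(#|{: F * 'I_n}|, n) :=
  \matrix_(a, b) (enum_val a == (x, b))%:R.

Lemma block_emb_ortho x y : (block_emb x)^T *m block_emb y = (x == y)%:R *: 1%:M.
Proof.
apply/matrixP => b c; rewrite !mxE (bigD1 (enum_rank (x, b))) //= big1 => [|a h].
  rewrite !mxE enum_rankK eqxx mul1r addr0 xpair_eqE -natrM mulnb.
  by [].
rewrite !mxE [_ == (x, b)](_ : _ = false) ?mul0r //.
by apply: contraNF h => /eqP <-; rewrite enum_valK.
Qed.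

Lemma block_emb_sum : \sum_x block_emb x *m (block_emb x)^T = 1%:M.
Proof.
apply/matrixP => a b; rewrite summxE.
transitivity (\sum_(p : F * 'I_n) (enum_val a == p)%:R * (enum_val b == p)%:R : R).
  rewrite -(pair_bigA _ (fun x i => (enum_val a == (x, i))%:R * (enum_val b == (x, i))%:R)) /=.
  by apply: eq_bigr => x _; rewrite !mxE; apply: eq_bigr => i _; rewrite !mxE.
rewrite (bigD1 (enum_val a)) //= big1 => [|p h].
  by rewrite eqxx mul1r addr0 mxE (inj_eq enum_val_inj) eq_sym.
by rewrite [_ == p](negbTE _) ?mul0r // eq_sym.
Qed.

End Emb.

Section Pencil.
Variables (R : realType) (g : nat).

Definition pencil m n (P : 'M[R]_m) (A : mxtuple R g m) (X : mxtuple R g n) :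
    'M[R]_(m * n) :=
  P *t 1%:M - \sum_j A j *t X j.

Lemma mul_pencil m n k (P : 'M[R]_m) A (X : mxtuple R g n) (U : 'M[R]_(k, n)) :
  (1%:M *t U) *m pencil P A X = P *t U - \sum_j A j *t (U *m X j).
Proof.
rewrite mulmxBr tensmx_mul mul1mx mulmx1 mulmx_sumr; congr (_ - _).
by apply: eq_bigr => j _; rewrite tensmx_mul mul1mx.
Qed.

Lemma pencil_mul m n k (P : 'M[R]_m) A (X : mxtuple R g n) (V : 'M[R]_(n, k)) :
  pencil P A X *m (1%:M *t V) = P *t V - \sum_j A j *t (X j *m V).
Proof.
rewrite mulmxBl tensmx_mul mul1mx mulmx1 mulmx_suml; congr (_ - _).
by apply: eq_bigr => j _; rewrite tensmx_mul mulmx1.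
Qed.

Lemma lim0_pencil m n (P : 'M[R]_m) A (f : R -> mxtuple R g n) (L : mxtuple R g n) :
  (forall j, lim0 (fun t => f t j) (L j)) ->
  lim0 (fun t => pencil P A (f t)) (pencil P A L).
Proof.
move=> h; apply: lim0D; first exact: lim0_cst.
apply: lim0N; apply: lim0_sum => j.
exact: lim0_tens.
Qed.

Lemma word_eval_cons n (M : mxtuple R g n) j w : word_eval M (j :: w) = M j *m word_eval M w.
Proof. by rewrite /word_eval big_cons. Qed.

Lemma word_eval_nil n (M : mxtuple R g n) : word_eval M [::] = 1%:M.
Proof. by rewrite /word_eval big_nil. Qed.

End Pencil.

Section Fock.
Variables (R : realType) (g n M : nat).

(* [None] is an isolated vertex, which will host the point chi. *)
Definition fock_dim := #|{: option (M.-bseq 'I_g) * 'I_n}|.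

(** Words longer than [M] get the zero embedding, so that formulas with [j :: v] truncate by
    themselves at length [M]. *)
Definition word_emb (w : seq 'I_g) : 'M[R]_(fock_dim, n) :=
  if insub w is Some b then block_emb R n (Some (b : M.-bseq 'I_g)) else 0.

Definition none_emb : 'M[R]_(fock_dim, n) := block_emb R n None.

Lemma word_emb_bseq (v : M.-bseq 'I_g) : word_emb v = block_emb R n (Some v).
Proof. by rewrite /word_emb valK. Qed.

Lemma word_emb_oversize w : (M < size w)%N -> word_emb w = 0.
Proof. by move=> h; rewrite /word_emb insubF // leqNgt h. Qed.

Lemma word_emb_ortho u v :
  (word_emb u)^T *m word_emb v = ((u == v) && (size u <= M)%N)%:R *: 1%:M.
Proof.
case: (leqP (size u) M) => hu; last by rewrite (word_emb_oversize hu) trmx0 mul0mx andbF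
    scale0r.
case: (leqP (size v) M) => hv; last first.
  rewrite (word_emb_oversize hv) mulmx0; case: eqP => [e|]; last by rewrite scale0r.
  by rewrite e leqNgt hv in hu.
rewrite -[u]/(val (Bseq hu)) -[v]/(val (Bseq hv)) !word_emb_bseq block_emb_ortho andbT.
by [].
Qed.

Lemma word_none_ortho w : (word_emb w)^T *m none_emb = 0.
Proof.
rewrite /word_emb; case: insubP => [b _ _|_]; last by rewrite trmx0 mul0mx.
by rewrite block_emb_ortho scale0r.
Qed.

Lemma none_word_ortho w : none_emb^T *m word_emb w = 0.
Proof. by apply: trmx_inj; rewrite trmx_mul trmxK word_none_ortho trmx0. Qed.

Lemma none_emb_ortho : none_emb^T *m none_emb = 1%:M.
Proof. by rewrite block_emb_ortho eqxx scale1r. Qed.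

Lemma fock_resolution :
  none_emb *m none_emb^T + \sum_(v : M.-bseq 'I_g) word_emb v *m (word_emb v)^T = 1%:M.
Proof.
rewrite -(block_emb_sum R (option (M.-bseq 'I_g)) n) (bigD1 None) //=; congr (_ + _).
rewrite (reindex_omap Some id) /=; last by case.
by apply: eq_big => [v|v _]; rewrite ?eqxx // word_emb_bseq.
Qed.

(** The left creation operators of the Fock space, truncated at length [M] and with multiplicity
    [n]. *)
Definition creation : mxtuple R g fock_dim :=
  fun j => \sum_(v : M.-bseq 'I_g) word_emb (j :: v) *m (word_emb v)^T.

Lemma none_emb_creation j : none_emb^T *m creation j = 0.
Proof.
by rewrite mulmx_sumr big1 // => v _; rewrite mulmxA none_word_ortho mul0mx.
Qed.

Lemma creation_none_emb j : creation j *m none_emb = 0.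
Proof.
by rewrite mulmx_suml big1 // => v _; rewrite -mulmxA word_none_ortho mulmx0.
Qed.

Lemma word_emb_creation_nil j : (word_emb [::])^T *m creation j = 0.
Proof.
by rewrite mulmx_sumr big1 // => v _; rewrite mulmxA word_emb_ortho scale0r mul0mx.
Qed.

Lemma word_emb_creation_cons i w j : (size (i :: w) <= M)%N ->
  (word_emb (i :: w))^T *m creation j = (i == j)%:R *: (word_emb w)^T.
Proof.
move=> h; have hw : (size w <= M)%N by apply: leq_trans h.
rewrite mulmx_sumr (bigD1 (Bseq hw)) //= big1 => [|v vw].
  by rewrite addr0 mulmxA word_emb_ortho h andbT eqseq_cons eqxx andbT -scalemxAl mul1mx.
rewrite mulmxA word_emb_ortho h andbT eqseq_cons.
have -> : (w == v) = false.
  by apply: contraNF vw => /eqP e; apply/eqP/val_inj; rewrite /= e.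
by rewrite andbF scale0r mul0mx.
Qed.

(** [t] to the power of the number operator on words, extended by the identity on the [None]
    block. *)
Definition dilation (t : R) : 'M[R]_fock_dim :=
  none_emb *m none_emb^T + \sum_(v : M.-bseq 'I_g) t ^+ size v *: (word_emb v *m (word_emb
      v)^T).

Lemma dilation_tr t : (dilation t)^T = dilation t.
Proof.
rewrite /dilation linearD /= trmx_mul trmxK linear_sum /=; congr (_ + _).
by apply: eq_bigr => v _; rewrite linearZ /= trmx_mul trmxK.
Qed.

Lemma dilation_word_emb t w : dilation t *m word_emb w = t ^+ size w *: word_emb w.
Proof.
case: (leqP (size w) M) => hw; last by rewrite (word_emb_oversize hw) mulmx0 scaler0.
rewrite mulmxDl -mulmxA none_word_ortho mulmx0 add0r mulmx_suml (bigD1 (Bseq hw)) //=.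
rewrite big1 => [|v vw].
  by rewrite addr0 -scalemxAl -mulmxA word_emb_ortho eqxx hw scale1r mulmx1.
rewrite -scalemxAl -mulmxA word_emb_ortho.
have -> : (val v == w) = false.
  by apply: contraNF vw => /eqP e; apply/eqP/val_inj; rewrite /= e.
by rewrite scale0r mulmx0 scaler0.
Qed.

Lemma word_emb_dilation t w : (word_emb w)^T *m dilation t = t ^+ size w *: (word_emb w)^T.
Proof. by apply: trmx_inj; rewrite trmx_mul trmxK dilation_tr dilation_word_emb linearZ /=
    trmxK. Qed.

Lemma dilation_creation t j : dilation t *m creation j = t *: (creation j *m dilation t).
Proof.
rewrite mulmx_sumr mulmx_suml scaler_sumr; apply: eq_bigr => v _.
by rewrite mulmxA dilation_word_emb -mulmxA word_emb_dilation -scalemxAl -scalemxAr scalerA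
    exprS.
Qed.

Definition fock_tuple (t : R) : mxtuple R g fock_dim := fun j => t *: (creation j + (creation
    j)^T).
(* [fock_tuple t] conjugated by [dilation t]: annihilation becomes negligible. *)
Definition fock_tilted (t : R) : mxtuple R g fock_dim := fun j => creation j + t ^+ 2 *:
    (creation j)^T.

Lemma fock_tuple_sym t : symtuple (fock_tuple t).
Proof. by move=> j; rewrite /fock_tuple linearZ linearD /= trmxK addrC. Qed.

(** The dilation passes a creation at the cost of a factor [t], and by transposition it passes an
    annihilation in the other direction; the weights 1 and [t ^+ 2] make both terms come out with
    weight [t]. *)
Lemma dilation_fock t j : dilation t *m fock_tilted t j = fock_tuple t j *m dilation t.
Proof.
rewrite /fock_tilted /fock_tuple mulmxDr dilation_creation -scalemxAl [in RHS]mulmxDl [in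
    RHS]scalerDr.
congr (_ + _); rewrite -scalemxAr.
have /(congr1 trmx) := dilation_creation t j; rewrite linearZ /= !trmx_mul dilation_tr => ->.
by rewrite scalerA expr2.
Qed.

Section Res.
Variables (m : nat) (P : 'M[R]_m) (A : mxtuple R g m).
Hypothesis uP : P \in unitmx.

Lemma dilation_pencil t :
  (1%:M *t dilation t) *m pencil P A (fock_tilted t) = pencil P A (fock_tuple t) *m (1%:M *t
      dilation t).
Proof.
by rewrite mul_pencil pencil_mul; congr (_ - _); apply: eq_bigr => j _; rewrite dilation_fock.
Qed.

Lemma pencil_creation_cons k (x : 'M[R]_(m * fock_dim, k)) i w :
  (size (i :: w) <= M)%N ->
  (1%:M *t (word_emb (i :: w))^T) *m (pencil P A creation *m x) =
  (P *t 1%:M) *m ((1%:M *t (word_emb (i :: w))^T) *m x)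
  - (A i *t 1%:M) *m ((1%:M *t (word_emb w)^T) *m x).
Proof.
move=> h; rewrite !mulmxA mul_pencil !tensmx_mul !mul1mx !mulmx1 -mulmxBl.
congr ((_ - _) *m _); rewrite (bigD1 i) //= big1 => [|j ji].
  by rewrite addr0 word_emb_creation_cons // eqxx scale1r.
by rewrite word_emb_creation_cons // eq_sym (negbTE ji) scale0r tensmx0.
Qed.

Lemma pencil_creation_nil k (x : 'M[R]_(m * fock_dim, k)) :
  (1%:M *t (word_emb [::])^T) *m (pencil P A creation *m x) =
  (P *t 1%:M) *m ((1%:M *t (word_emb [::])^T) *m x).
Proof.
rewrite !mulmxA mul_pencil !tensmx_mul !mul1mx !mulmx1 big1 ?subr0 // => j _.
by rewrite word_emb_creation_nil tensmx0.
Qed.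

Lemma pencil_creation_none k (x : 'M[R]_(m * fock_dim, k)) :
  (1%:M *t none_emb^T) *m (pencil P A creation *m x) =
  (P *t 1%:M) *m ((1%:M *t none_emb^T) *m x).
Proof.
rewrite !mulmxA mul_pencil !tensmx_mul !mul1mx !mulmx1 big1 ?subr0 // => j _.
by rewrite none_emb_creation tensmx0.
Qed.

Let P1 := tensmx_inv n uP.

(** The pencil is block triangular for word length, with [P] on the diagonal: the blocks of a kernel
    vector vanish by induction on the word, and the [None] block separately. *)
Lemma pencil_creation_unit : pencil P A creation \in unitmx.
Proof.
have [uP1 _] := P1.
apply: unitmx_inj => x e.
have h0 : (1%:M *t none_emb^T) *m x = 0.
  by have := pencil_creation_none x; rewrite e mulmx0 => /esym/(congr1 (mulmx (invmx (P *t
      1%:M)))); rewrite mulKmx // mulmx0.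
have h1 w : (size w <= M)%N -> (1%:M *t (word_emb w)^T) *m x = 0.
  elim: w => [|i w IH] hw.
    by have := pencil_creation_nil x; rewrite e mulmx0 => /esym/(congr1 (mulmx (invmx (P *t
        1%:M)))); rewrite mulKmx // mulmx0.
  have := pencil_creation_cons x hw; rewrite IH; last exact: leq_trans hw.
  rewrite e !mulmx0 subr0 => /esym/(congr1 (mulmx (invmx (P *t 1%:M)))).
  by rewrite mulKmx // mulmx0.
rewrite -[x]mul1mx -tensmx11 -fock_resolution tensmxDr tensmx_sumr mulmxDl mulmx_suml.
have e2 (U : 'M[R]_(fock_dim, n)) : (1%:M : 'M[R]_m) *t (U *m U^T) *m x = (1%:M *t U) *m
    ((1%:M *t U^T) *m x).
  by rewrite mulmxA tensmx_mul mulmx1.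
rewrite e2 h0 mulmx0 add0r big1 // => v _.
by rewrite e2 h1 ?mulmx0 // size_bseq.
Qed.

(** The coefficient of the word [w] in the expansion of [(P - L_A(x))^-1] at 0; for [P = J] it is
    [(JA)^w J]. *)
Definition moment (w : seq 'I_g) : 'M[R]_m :=
  word_eval (fun j => invmx P *m A j) w *m invmx P.

(** Forward substitution: the block at [i :: w] is [P^-1 A_i] times the block at [w], starting from
    [P^-1] at the empty word. *)
Lemma pencil_creation_col w : (size w <= M)%N ->
  (1%:M *t (word_emb w)^T) *m (invmx (pencil P A creation) *m (1%:M *t word_emb [::])) =
  moment w *t 1%:M.
Proof.
have [uP1 iP1] := P1.
set x := invmx _ *m _; have ex : pencil P A creation *m x = 1%:M *t word_emb [::].
  by rewrite mulKVmx // pencil_creation_unit.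
elim: w => [|i w IH] hw.
  have := pencil_creation_nil x; rewrite ex tensmx_mul mul1mx word_emb_ortho eqxx scale1r
      tensmx11.
  move=> /esym/(congr1 (mulmx (invmx (P *t 1%:M)))).
  by rewrite mulKmx // mulmx1 iP1 /moment word_eval_nil mul1mx.
have := pencil_creation_cons x hw; rewrite IH; last exact: leq_trans hw.
rewrite ex tensmx_mul mul1mx word_emb_ortho scale0r tensmx0 tensmx_mul mul1mx => /esym/eqP.
rewrite subr_eq0 => /eqP/(congr1 (mulmx (invmx (P *t 1%:M)))).
by rewrite mulKmx // iP1 tensmx_mul mul1mx /moment word_eval_cons !mulmxA.
Qed.

Lemma lim0_fock_tilted :
  small (fun t => pencil P A (fock_tilted t) \in unitmx) /\ lim0 (fun t => invmx (pencil P A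
      (fock_tilted t))) (invmx (pencil P A creation)).
Proof.
apply: lim0V; first exact: pencil_creation_unit.
apply: lim0_pencil => j; rewrite -[creation j in X in lim0 _ X]addr0.
by apply: lim0D; [exact: lim0_cst | exact: lim0_scale].
Qed.

Lemma lim0_fock_tuple :
  small (fun t => pencil P A (fock_tuple t) \in unitmx) /\ lim0 (fun t => invmx (pencil P A
      (fock_tuple t))) (invmx P *t 1%:M).
Proof.
have [uP1 <-] := tensmx_inv fock_dim uP.
have -> : P *t 1%:M = pencil P A (fun=> 0 : 'M[R]_fock_dim).
  by rewrite /pencil big1 ?subr0 // => j _; rewrite tensmx0.
apply: lim0V.
  by rewrite /pencil big1 ?subr0 // => j _; rewrite tensmx0.
apply: lim0_pencil => j.
exact: (lim0_scale _ 0).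
Qed.

(** Conjugation by the dilation carries one resolvent into the other; it contributes [t ^+ size w]
    on the left and nothing on the right, since the empty word has length 0. *)
Lemma fock_col t w :
  pencil P A (fock_tilted t) \in unitmx -> pencil P A (fock_tuple t) \in unitmx ->
  (1%:M *t (word_emb w)^T) *m (invmx (pencil P A (fock_tuple t)) *m (1%:M *t word_emb [::])) =
  t ^+ size w *:
    ((1%:M *t (word_emb w)^T) *m (invmx (pencil P A (fock_tilted t)) *m (1%:M *t word_emb
        [::]))).
Proof.
move=> u1 u2.
have h : invmx (pencil P A (fock_tuple t)) *m (1%:M *t dilation t) =
         (1%:M *t dilation t) *m invmx (pencil P A (fock_tilted t)).
  by rewrite -[RHS](mulKmx u2) !mulmxA -[_ *m pencil _ _ _ *m _]mulmxA -dilation_pencil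
      -!mulmxA mulmxV // mulmx1.
have -> : (1%:M : 'M[R]_m) *t word_emb [::] = (1%:M *t dilation t) *m (1%:M *t word_emb [::]).
  by rewrite tensmx_mul mulmx1 dilation_word_emb expr0 scale1r.
rewrite [invmx _ *m _]mulmxA h -!mulmxA [LHS]mulmxA tensmx_mul mul1mx word_emb_dilation.
rewrite tensmxZr -scalemxAl; congr (_ *: (_ *m (_ *m _))).
by rewrite tensmx_mul mulmx1 dilation_word_emb expr0 scale1r.
Qed.

End Res.
End Fock.

(** * Linearization of rational expressions *)

Section Blk.
Variables (R : realType) (p q n : nat).

Let e1 : 'M[R]_(p + q, p) := col_mx 1%:M 0.
Let e2 : 'M[R]_(p + q, q) := col_mx 0 1%:M.
Let E1 : 'M[R]_((p + q) * n, p * n) := e1 *t 1%:M.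
Let E2 : 'M[R]_((p + q) * n, q * n) := e2 *t 1%:M.

(** A 2 x 2 block matrix whose dimension is [(p + q) * n] instead of [p * n + q * n], as Kronecker
    products require; it is assembled from the inclusions [E1] and [E2]. *)
Definition tblk (a : 'M[R]_(p * n)) (b : 'M[R]_(p * n, q * n)) (c : 'M[R]_(q * n, p * n)) (d
    : 'M[R]_(q * n)) :
    'M[R]_((p + q) * n) :=
  E1 *m (a *m E1^T + b *m E2^T) + E2 *m (c *m E1^T + d *m E2^T).

Let e11 : e1^T *m e1 = 1%:M.
Proof. by rewrite tr_col_mx mul_row_col trmx1 mulmx1 mulmx0 addr0. Qed.
Let e22 : e2^T *m e2 = 1%:M.
Proof. by rewrite tr_col_mx mul_row_col trmx1 mulmx1 mulmx0 add0r. Qed.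
Let e12 : e1^T *m e2 = 0.
Proof. by rewrite tr_col_mx mul_row_col trmx1 mulmx0 mulmx1 add0r trmx0. Qed.
Let e21 : e2^T *m e1 = 0.
Proof. by apply: trmx_inj; rewrite trmx_mul trmxK e12 trmx0. Qed.
Let esum : e1 *m e1^T + e2 *m e2^T = 1%:M.
Proof.
rewrite !tr_col_mx !mul_col_row !trmx1 !trmx0 !mulmx0 !mul0mx !mulmx1 add_block_mx.
by rewrite !addr0 !add0r -scalar_mx_block.
Qed.

Let E11 : E1^T *m E1 = 1%:M.
Proof. by rewrite trmx_tens tensmx_mul e11 trmx1 mulmx1 tensmx11. Qed.
Let E22 : E2^T *m E2 = 1%:M.
Proof. by rewrite trmx_tens tensmx_mul e22 trmx1 mulmx1 tensmx11. Qed.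
Let E12 : E1^T *m E2 = 0.
Proof. by rewrite trmx_tens tensmx_mul e12 tens0mx. Qed.
Let E21 : E2^T *m E1 = 0.
Proof. by rewrite trmx_tens tensmx_mul e21 tens0mx. Qed.
Let Esum : E1 *m E1^T + E2 *m E2^T = 1%:M.
Proof. by rewrite !trmx_tens !tensmx_mul trmx1 mulmx1 -tensmxDl esum tensmx11. Qed.

Lemma tblk_mul a b c d a' b' c' d' :
  tblk a b c d *m tblk a' b' c' d' =
  tblk (a *m a' + b *m c') (a *m b' + b *m d') (c *m a' + d *m c') (c *m b' + d *m d').
Proof.
have h k1 (x : 'M[R]_(k1, p * n)) (y : 'M[R]_(k1, q * n)) r s :
    (x *m E1^T + y *m E2^T) *m (E1 *m r + E2 *m s) = x *m r + y *m s :> 'M[R]_(_, (p + q) * n).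
  rewrite mulmxDr !mulmxDl !mulmxA -![_ *m _^T *m _]mulmxA E11 E12 E21 E22.
  by rewrite !mulmx0 !mulmx1 !mul0mx addr0 add0r.
have h2 k1 (x : 'M[R]_(k1, p * n)) (y : 'M[R]_(k1, q * n)) :
    (x *m E1^T + y *m E2^T) *m tblk a' b' c' d' =
    (x *m a' + y *m c') *m E1^T + (x *m b' + y *m d') *m E2^T.
  by rewrite h !mulmxDr !mulmxDl !mulmxA addrACA.
by rewrite [in LHS]/tblk mulmxDl -!mulmxA -/(tblk _ _ _ _) !h2.
Qed.

Lemma tblk1 : tblk 1%:M 0 0 1%:M = 1%:M.
Proof. by rewrite /tblk !mul0mx addr0 add0r !mul1mx Esum. Qed.

Lemma tblk_form k1 k2 (u : 'M[R]_(k1, p)) (v : 'M[R]_(k1, q)) (x : 'M[R]_(p, k2)) (y :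
    'M[R]_(q, k2)) a b c d :
  (row_mx u v *t 1%:M) *m tblk a b c d *m (col_mx x y *t 1%:M) =
  (u *t 1%:M) *m (a *m (x *t 1%:M) + b *m (y *t 1%:M)) +
  (v *t 1%:M) *m (c *m (x *t 1%:M) + d *m (y *t 1%:M)).
Proof.
have r1 : (row_mx u v *t 1%:M) *m E1 = u *t (1%:M : 'M[R]_n).
  by rewrite tensmx_mul mul_row_col !mulmx1 mulmx0 addr0.
have r2 : (row_mx u v *t 1%:M) *m E2 = v *t (1%:M : 'M[R]_n).
  by rewrite tensmx_mul mul_row_col !mulmx1 mulmx0 add0r.
have c1 : E1^T *m (col_mx x y *t 1%:M) = x *t (1%:M : 'M[R]_n).
  by rewrite trmx_tens tensmx_mul tr_col_mx mul_row_col !trmx1 trmx0 !mul1mx mul0mx addr0.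
have c2 : E2^T *m (col_mx x y *t 1%:M) = y *t (1%:M : 'M[R]_n).
  by rewrite trmx_tens tensmx_mul tr_col_mx mul_row_col !trmx1 trmx0 !mul1mx mul0mx add0r.
rewrite /tblk -mulmxA mulmxDl -!mulmxA (mulmxDr _ (E1 *m _)) !mulmxA r1 r2.
by rewrite -!mulmxA !mulmxDl -!mulmxA c1 c2.
Qed.

Lemma tens_blockX a b c d (X : 'M[R]_n) :
  block_mx a b c d *t X = tblk (a *t X) (b *t X) (c *t X) (d *t X).
Proof.
have -> : block_mx a b c d = e1 *m (a *m e1^T + b *m e2^T) + e2 *m (c *m e1^T + d *m e2^T).
  rewrite !tr_col_mx !mul_mx_row !trmx1 !trmx0 !mulmx1 !mulmx0 !add_row_mx !addr0 !add0r.
  by rewrite !mul_col_mx !mul1mx !mul0mx add_col_mx addr0 add0r.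
by rewrite /tblk !trmx_tens !tensmx_mul -!tensmxDl !tensmx_mul -tensmxDl !trmx1 !mulmx1 !mul1mx.
Qed.

Lemma tblkD a b c d a' b' c' d' :
  tblk a b c d + tblk a' b' c' d' = tblk (a + a') (b + b') (c + c') (d + d').
Proof.
rewrite /tblk addrACA -!mulmxDr ![(_ + _) *m _^T]mulmxDl.
by congr (_ + _); rewrite [in LHS]addrACA.
Qed.

Lemma tblkN a b c d : - tblk a b c d = tblk (- a) (- b) (- c) (- d).
Proof. by rewrite /tblk opprD -!mulmxN !opprD -!mulNmx. Qed.

Lemma tblk0 : tblk 0 0 0 0 = 0.
Proof. by rewrite /tblk !mul0mx !addr0 !mulmx0 addr0. Qed.

End Blk.

Section Lin.
Variables (R : realType) (g : nat).

Lemma pencil_block p q n (Pa : 'M[R]_p) Pb Pc (Pd : 'M[R]_q) Aa Ab Ac Ad (X : mxtuple R g n) :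
  pencil (block_mx Pa Pb Pc Pd) (fun j => block_mx (Aa j) (Ab j) (Ac j) (Ad j)) X =
  tblk (Pa *t 1%:M - \sum_j Aa j *t X j) (Pb *t 1%:M - \sum_j Ab j *t X j)
       (Pc *t 1%:M - \sum_j Ac j *t X j) (Pd *t 1%:M - \sum_j Ad j *t X j).
Proof.
rewrite -tblkD -tblkN -tens_blockX /pencil; congr (_ - _).
have h (s : seq 'I_g) : \sum_(j <- s) block_mx (Aa j) (Ab j) (Ac j) (Ad j) *t X j =
  tblk (\sum_(j <- s) Aa j *t X j) (\sum_(j <- s) Ab j *t X j) (\sum_(j <- s) Ac j *t X j)
      (\sum_(j <- s) Ad j *t X j).
  elim: s => [|j s IH]; first by rewrite !big_nil tblk0.
  by rewrite !big_cons IH tens_blockX tblkD.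
exact: h.
Qed.

(* On [ev], [f] is given by an invertible affine pencil, at all sizes at once. *)
Definition realized k1 k2 (ev : forall n, mxtuple R g n -> Prop)
    (f : forall n, mxtuple R g n -> 'M[R]_(k1 * n, k2 * n)) : Prop :=
  exists m (P : 'M[R]_m) (A : mxtuple R g m) (c : 'M[R]_(k1, m)) (b : 'M[R]_(m, k2)),
  forall n (X : mxtuple R g n), ev n X ->
    exists2 S, pencil P A X *m S = 1%:M & f n X = (c *t 1%:M) *m S *m (b *t 1%:M).

Lemma sum0tens m p n (X : mxtuple R g n) : \sum_j (0 : 'M[R]_(m, p)) *t X j = 0.
Proof. by rewrite big1 // => j _; rewrite tens0mx. Qed.

Lemma realized_cst k1 k2 ev (M : 'M[R]_(k1, k2)) :
  realized ev (fun n _ => M *t 1%:M).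
Proof.
exists k2, 1%:M, (fun=> 0), M, 1%:M => n X _; exists 1%:M.
  by rewrite /pencil sum0tens subr0 tensmx11 mulmx1.
by rewrite tensmx11 !mulmx1.
Qed.

Lemma realized_add k1 k2 ev f f' :
  realized ev f -> realized ev f' ->
  @realized k1 k2 ev (fun n X => f n X + f' n X).
Proof.
move=> [m [P [A [c [b h]]]]] [m' [P' [A' [c' [b' h']]]]].
exists (m + m')%N, (block_mx P 0 0 P'), (fun j => block_mx (A j) 0 0 (A' j)), (row_mx c c'),
    (col_mx b b').
move=> n X e; have [S hS ->] := h n X e; have [S' hS' ->] := h' n X e.
exists (tblk S 0 0 S').
  rewrite pencil_block tblk_mul hS hS' !sum0tens !tens0mx !subr0.
  by rewrite !mul0mx !mulmx0 !addr0 !add0r tblk1.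
by rewrite tblk_form !mul0mx addr0 add0r !mulmxA.
Qed.

(** The block [- b c'] above the diagonal feeds the second system into the first: the upper right
    block of the inverse is [S b c' S']. *)
Lemma realized_mul k1 k2 k3 ev f f' :
  @realized k1 k2 ev f -> realized ev f' ->
  @realized k1 k3 ev (fun n X => f n X *m f' n X).
Proof.
move=> [m [P [A [c [b h]]]]] [m' [P' [A' [c' [b' h']]]]].
exists (m + m')%N, (block_mx P (- (b *m c')) 0 P'), (fun j => block_mx (A j) 0 0 (A' j)),
    (row_mx c 0), (col_mx 0 b').
move=> n X e; have [S hS ->] := h n X e; have [S' hS' ->] := h' n X e.
pose K := (b *t (1%:M : 'M[R]_n)) *m (c' *t 1%:M).
exists (tblk S (S *m K *m S') 0 S').
  rewrite pencil_block tblk_mul hS hS' !sum0tens !tens0mx !subr0.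
  rewrite !mul0mx !mulmx0 !addr0 !add0r !mulmxA hS mul1mx.
  have -> : (- (b *m c')) *t (1%:M : 'M[R]_n) = - K by rewrite tensmxNl /K tensmx_mul mulmx1.
  by rewrite mulNmx subrr tblk1.
by rewrite tblk_form !tens0mx !mul0mx !mulmx0 !addr0 !add0r !mulmxA.
Qed.

(** Bordering the pencil by [b] and [- c] makes [c S b] its Schur complement, so the lower right
    block of the inverse is [f^-1]. *)
Lemma realized_inv k (ev : forall n, mxtuple R g n -> Prop) f :
  @realized k k ev f ->
  @realized k k (fun n X => ev n X /\ f n X \in unitmx) (fun n X => invmx (f n X)).
Proof.
move=> [m [P [A [c [b h]]]]].
exists (m + k)%N, (block_mx P b (- c) 0), (fun j => block_mx (A j) 0 0 0), (row_mx 0 1%:M),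
    (col_mx 0 1%:M).
move=> n X [e u]; have [S hS ef] := h n X e.
set F := invmx _; set bb := b *t 1%:M in ef; set cc := c *t 1%:M in ef.
exists (tblk (S - S *m bb *m F *m cc *m S) (- (S *m bb *m F)) (F *m cc *m S) F).
  rewrite pencil_block tblk_mul !sum0tens !tens0mx !subr0 !mul0mx !addr0.
  rewrite tensmxNl -/bb -/cc mulmxBr !mulmxN !mulNmx !mulmxA hS !mul1mx opprK.
  rewrite subrK addNr mulmxBr !mulmxA -ef.
  by rewrite /F mulmxV // mul1mx subrr oppr0 tblk1.
by rewrite tblk_form !tens0mx !mul0mx !mulmx0 !add0r tensmx11 mul1mx mulmx1.
Qed.

Lemma realized_var k ev j : @realized k k ev (fun n X => 1%:M *t X j).
Proof.
exists (k + k)%N, (block_mx 1%:M 0 0 1%:M), (fun i => block_mx 0 (i == j)%:R%:M 0 0), (row_mx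
    1%:M 0), (col_mx 0 1%:M).
move=> n X _; exists (tblk 1%:M (1%:M *t X j) 0 1%:M).
  rewrite pencil_block !sum0tens !tens0mx !subr0 (bigD1 j) //= big1; last first.
    by move=> i /negbTE ->; rewrite raddf0 tens0mx.
  rewrite eqxx addr0 sub0r tblk_mul !tensmx11 !mul0mx !mulmx0 !mul1mx !mulmx1.
  by rewrite !addr0 add0r subrr tblk1.
by rewrite tblk_form !tens0mx !mul0mx !mulmx0 !add0r !addr0 tensmx11 mul1mx mulmx1.
Qed.

Lemma realized_ext k1 k2 ev ev' f f' :
  (forall n X, ev' n X -> ev n X) -> (forall n X, ev' n X -> f n X = f' n X) ->
  @realized k1 k2 ev f -> @realized k1 k2 ev' f'.
Proof.
move=> h e [m [P [A [c [b H]]]]]; exists m, P, A, c, b => n X E.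
by have [S hS fS] := H n X (h _ _ E); exists S; rewrite -?e.
Qed.

Lemma realized_word k ev w : @realized k k ev (fun n X => 1%:M *t word_eval X w).
Proof.
elim: w => [|j w IH].
  apply: (realized_ext _ _ (realized_cst ev 1%:M)) => // n X _.
  by rewrite word_eval_nil.
apply: (realized_ext _ _ (realized_mul (realized_var k ev j) IH)) => // n X _.
by rewrite tensmx_mul mul1mx word_eval_cons.
Qed.

Lemma realized_rat k1 k2 (s : ratexpr R g k1 k2) :
  realized (fun n X => rat_evaluable s X) (fun n X => rat_eval s X).
Proof.
elim: s => {k1 k2} [k1 k2 p|k1 k2 s hs t ht|k1 k2 k3 s hs t ht|k s hs] /=.
- elim: (enum_fset (finsupp p)) => [|w ws IH].
    apply: (realized_ext _ _ (realized_cst _ (0 : 'M[R]_(k1, k2)))) => // n X _.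
    by rewrite big_nil tens0mx.
  apply: (realized_ext _ _ (realized_add (realized_mul (realized_cst _ (p w)) (realized_word
      k2 _ w)) IH)) => // n X _.
  by rewrite big_cons tensmx_mul mulmx1 mul1mx.
- pose ev n (X : mxtuple R g n) := rat_evaluable s X /\ rat_evaluable t X.
  have hs' := realized_ext (ev' := ev) (fun n X h => proj1 h) (fun _ _ _ => erefl) hs.
  have ht' := realized_ext (ev' := ev) (fun n X h => proj2 h) (fun _ _ _ => erefl) ht.
  exact: realized_add hs' ht'.
- pose ev n (X : mxtuple R g n) := rat_evaluable s X /\ rat_evaluable t X.
  have hs' := realized_ext (ev' := ev) (fun n X h => proj1 h) (fun _ _ _ => erefl) hs.
  have ht' := realized_ext (ev' := ev) (fun n X h => proj2 h) (fun _ _ _ => erefl) ht.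
  exact: realized_mul hs' ht'.
- exact: realized_inv hs.
Qed.
End Lin.

Lemma tensmx1_inj (R : pzRingType) m n (A B : 'M[R]_(m, n)) k :
  A *t (1%:M : 'M[R]_k.+1) = B *t 1%:M -> A = B.
Proof.
move=> h; apply/matrixP => i j.
have := congr1 (fun M : 'M[R]__ => M (mxtens_index (i, ord0)) (mxtens_index (j, ord0))) h.
by rewrite !tensmxE mxE eqxx !mulr1.
Qed.

(** * Moments *)

Section Near0.
Variables (R : realType) (g : nat).

Lemma word_eval_scale n (X : mxtuple R g n) t w :
  word_eval (fun j => t *: X j) w = t ^+ size w *: word_eval X w.
Proof.
elim: w => [|j w IH]; first by rewrite !word_eval_nil scale1r.
by rewrite !word_eval_cons IH -scalemxAl -scalemxAr scalerA exprS.
Qed.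

(** Every inverted subexpression tends to its value at 0, which is invertible by [analytic0], so
    evaluability persists near 0 on each ray. *)
Lemma rat_near0 k1 k2 (s : ratexpr R g k1 k2) n (X : mxtuple R g n) :
  analytic0 s ->
  small (fun t => rat_evaluable s (fun j => t *: X j)) /\
  lim0 (fun t => rat_eval s (fun j => t *: X j)) (rat_val0 s *t 1%:M).
Proof.
elim: s => {k1 k2} [k1 k2 p|k1 k2 s hs t ht|k1 k2 k3 s hs t ht|k s hs] /=.
- move=> _; split; first by exists 1.
  (* Only the empty word survives in the limit; it may lie outside the support, where [p [::]] is
     the default 0. *)
  have -> : p [::] *t 1%:M = \sum_(w <- finsupp p) (if w == [::] then p [::] else 0) *t (1%:M
      : 'M[R]_n).
    have [h|h] := boolP ([::] \in finsupp p).
      rewrite (bigD1_seq [::]) ?fset_uniq //= big1 ?addr0 // => w /negbTE ->.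
      by rewrite tens0mx.
    rewrite (fsfun_dflt h) tens0mx big_seq big1 // => w hw.
    by case: eqP => [e|_]; rewrite tens0mx.
  apply: lim0_sum => -[|j w] /=.
    apply: lim0_eq (lim0_cst _); exists 1 => // t _ _; by rewrite word_eval_nil.
  rewrite tens0mx -(@tensmx0 _ _ _ n n (p (j :: w))); apply: lim0_tens.
  apply: lim0_eq (lim0_scale (word_eval X (j :: w)) (size w)).
  by exists 1 => // t _ _; rewrite word_eval_scale.
- move=> [/hs[s1 l1] /ht[s2 l2]]; split; first exact: small_and.
  by rewrite tensmxDl; exact: lim0D.
- move=> [/hs[s1 l1] /ht[s2 l2]]; split; first exact: small_and.
  by rewrite -[1%:M]mulmx1 -tensmx_mul; exact: lim0M.
- move=> [/hs[s1 l1] u].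
  have [u1 e1] := tensmx_inv n u; have [s2 l2] := lim0V u1 l1.
  by split; [exact: small_and | rewrite -e1].
Qed.

(** Recovers moments from values near 0: the entry from the empty word to [w] carries the factor
    [t ^+ size w], and what remains comes from the tilted resolvent, which tends to that of
    [creation]. *)
Lemma fock_moment m n M k1 k2 (P : 'M[R]_m) (A : mxtuple R g m) (c : 'M[R]_(k1, m)) (b :
    'M[R]_(m, k2)) w :
  P \in unitmx -> (size w <= M)%N ->
  lim0 (fun t => (t ^- size w) *: ((1%:M *t (word_emb R n M w)^T) *m
      ((c *t 1%:M) *m invmx (pencil P A (fock_tuple n M t)) *m (b *t 1%:M)) *m
      (1%:M *t word_emb R n M [::])))
    ((c *m moment P A w *m b) *t 1%:M).
Proof.
move=> uP hw; have [u1 l1] := lim0_fock_tilted n M A uP.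
have [u2 _] := lim0_fock_tuple n M A uP.
have eL : (1%:M *t (word_emb R n M w)^T) *m (c *t 1%:M) = (c *t 1%:M) *m (1%:M *t (word_emb R
    n M w)^T).
  by rewrite !tensmx_mul !mulmx1 !mul1mx.
have eR : (b *t 1%:M) *m (1%:M *t @word_emb R g n M [::]) = (1%:M *t @word_emb R g n M [::])
    *m (b *t 1%:M).
  by rewrite !tensmx_mul !mulmx1 !mul1mx.
have l2 : lim0 (fun t => (c *t 1%:M) *m ((1%:M *t (word_emb R n M w)^T) *m
    (invmx (pencil P A (fock_tilted n M t)) *m (1%:M *t word_emb R n M [::]))) *m (b *t 1%:M))
    ((c *t 1%:M) *m ((1%:M *t (word_emb R n M w)^T) *m
    (invmx (pencil P A (creation R n M)) *m (1%:M *t word_emb R n M [::]))) *m (b *t 1%:M)).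
  apply: lim0M (lim0_cst _); apply: (lim0M (lim0_cst _)); apply: (lim0M (lim0_cst _)).
  exact: lim0M l1 (lim0_cst _).
rewrite pencil_creation_col // !tensmx_mul !mulmx1 in l2.
apply: lim0_eq l2; apply: small_impl (small_and u1 u2) => t t0 [ut1 ut2].
rewrite -[_ *m invmx _ *m _]mulmxA !mulmxA eL -!mulmxA eR.
have := fock_col w ut1 ut2; set G := invmx _; set H := invmx _ => e.
rewrite [G *m _]mulmxA [(1%:M *t (word_emb R n M w)^T) *m (G *m _ *m _)]mulmxA e.
rewrite -scalemxAl -scalemxAr scalerA mulVf ?scale1r //.
  by rewrite !mulmxA.
by rewrite expf_neq0 // lt0r_neq0.
Qed.

End Near0.

Lemma word_eval_cat (R : realType) g n (M : mxtuple R g n) u v :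
  word_eval M (u ++ v) = word_eval M u *m word_eval M v.
Proof.
elim: u => [|j u IH]; first by rewrite word_eval_nil mul1mx.
by rewrite !word_eval_cons IH mulmxA.
Qed.

Section Minimal.
Variables (R : realType) (g d l : nat) (r : descriptor R g d l).
Local Notation J := (desJ r).
Local Notation Am := (desA r).
Local Notation C := (desC r).

Lemma desJ_unit : J \in unitmx.
Proof. by case: (mulmx1_unit (desJ_invol r)). Qed.

Lemma desJ_inv : invmx J = J.
Proof. by rewrite -[LHS]mulmx1 -(desJ_invol r) mulKmx // desJ_unit. Qed.

Lemma moment_tr w : (moment J Am w)^T = moment J Am (rev w).
Proof.
rewrite /moment desJ_inv; elim: w => [|j w IH].
  by rewrite word_eval_nil mul1mx desJ_sym.
rewrite word_eval_cons rev_cons -cats1 word_eval_cat word_eval_cons word_eval_nil mulmx1.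
by rewrite -!mulmxA !(trmx_mul J) trmx_mul IH desJ_sym desA_sym !mulmxA.
Qed.

(** The controllability span in matrix form: the coefficients on the right are matrices, so that the
    identity itself can be expanded in moments. *)
Definition spanned k (B : 'M[R]_(d, k)) : Prop :=
  exists s : seq (seq 'I_g * 'M[R]_(l, k)), \sum_(p <- s) moment J Am p.1 *m C *m p.2 = B.

Lemma spanned0 k : spanned (0 : 'M[R]_(d, k)).
Proof. by exists [::]; rewrite big_nil. Qed.

Lemma spannedD k (B B' : 'M[R]_(d, k)) : spanned B -> spanned B' -> spanned (B + B').
Proof. by move=> [s <-] [s' <-]; exists (s ++ s'); rewrite big_cat. Qed.

Lemma spannedM k k' (B : 'M[R]_(d, k)) (N : 'M[R]_(k, k')) : spanned B -> spanned (B *m N).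
Proof.
move=> [s <-]; exists [seq (p.1, p.2 *m N) | p <- s].
by rewrite big_map mulmx_suml; apply: eq_bigr => p _ /=; rewrite mulmxA.
Qed.

Lemma minimal_spanned : minimal r -> spanned (1%:M : 'M[R]_d).
Proof.
move=> hmin.
have hv (v : 'cV[R]_d) : spanned v.
  have [s sS vs] := hmin v.
  rewrite (coord_span (X := in_tuple s) vs); apply: (big_ind (@spanned 1)).
  - exact: spanned0.
  - exact: spannedD.
  move=> i _.
  have [w [h ->]] := sS _ (mem_nth 0 (ltn_ord i)).
  exists [:: (w, coord (in_tuple s) i v *: h)].
  by rewrite big_seq1 /= -scalemxAr /moment desJ_inv.
have -> : 1%:M = \sum_(a < d) (delta_mx a 0 : 'cV[R]_d) *m (delta_mx 0 a : 'rV[R]_d).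
  rewrite scalar_mx_sum_delta; apply: eq_bigr => a _.
  by rewrite mul_delta_mx scale1r.
by apply: big_ind; [exact: spanned0 | exact: spannedD | move=> a _; exact: spannedM].
Qed.

End Minimal.

(** * Invertibility on the algebraic domain *)

Lemma annihilating_poly (F : fieldType) n (L : 'M[F]_n) :
  exists2 q : {poly F}, q.[1] = \det (1%:M - L) &
    \sum_(i < size q) q`_i *: iter i (fun B => B *m L) 1%:M = 0.
Proof.
(* Cayley-Hamilton lives in the ring of matrices of positive dimension; in dimension 0 the constant
   1 annihilates, and the determinant is 1. *)
case: n L => [|n] L.
  exists 1; first by rewrite hornerC det_mx00.
  by apply/matrixP; case.
exists (char_poly L).
  rewrite -[_.[1]]/(horner_eval 1 _) /char_poly -det_map_mx; congr (\det _).
  by apply/matrixP => i j; rewrite !mxE /= /horner_eval hornerD hornerN hornerMn hornerX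
      hornerC.
rewrite -[RHS](Cayley_Hamilton L) -[in RHS](coefK (char_poly L)) poly_def linear_sum.
apply: eq_bigr => i _ /=; rewrite linearZ rmorphXn /= horner_mx_X; congr (_ *: _).
by elim: (nat_of_ord i) => [|k IH] //; rewrite iterS IH exprSr.
Qed.

Section Alg.
Variables (R : realType) (g d l : nat) (r : descriptor R g d l).
Local Notation J := (desJ r).
Local Notation Am := (desA r).
Local Notation C := (desC r).

Lemma pencil0_unit m n (P : 'M[R]_m) (A : mxtuple R g m) (S : 'M[R]_(m * n.+1)) :
  pencil P A (fun=> 0) *m S = 1%:M -> P \in unitmx.
Proof.
move=> h; apply: unitmx_inj => x hx; apply: (@tensmx1_inj _ _ _ _ _ n).
have [u _] := mulmx1_unit h.
rewrite -[LHS](mulKmx u) /pencil big1 => [|j _]; last by rewrite tensmx0.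
by rewrite subr0 tensmx_mul hx !tens0mx mulmx0.
Qed.

(** Both expressions are evaluated at the same small Fock-space tuple, where they agree; after
    rescaling by [t ^- size w] both sides converge to their moments, and limits are unique. *)
Lemma equiv_moment (s : ratexpr R g l l) :
  analytic0 s -> equiv_des r s ->
  exists m (P : 'M[R]_m) (A : mxtuple R g m) (c : 'M[R]_(l, m)) (b : 'M[R]_(m, l)),
  [/\ P \in unitmx,
      forall n (X : mxtuple R g n), domfor s n X -> pencil P A X \in unitmx &
      forall w, C^T *m moment J Am w *m C = c *m moment P A w *m b].
Proof.
move=> an eq.
(* Subtracting [D] from [s] leaves a pure resolvent to compare with that of [r]. *)
have [m [P [A [c [b h]]]]] := realized_add (realized_rat s)
  (realized_cst (fun n X => rat_evaluable s X) (- desD r)).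
exists m, P, A, c, b.
(* At the zero tuple of size 1 the pencil is [P], and [s] is evaluable there because it is analytic
   at 0. *)
have uP : P \in unitmx.
  have [s1 _] := rat_near0 (fun=> 0 : 'M[R]_1) an.
  have [t _ ht] := small_ex s1; have [S hS _] := h _ _ ht.
  apply: (@pencil0_unit _ 0 P A S); rewrite -hS; congr (pencil _ _ _ *m _).
  by apply/funext => j; rewrite scaler0.
split=> // [n X [_ eX]|w].
  by have [S hS _] := h _ _ eX; case: (mulmx1_unit hS).
pose M := size w.
have l1 := fock_moment 1 Am C^T C (desJ_unit r) (leqnn M).
have l2 := fock_moment 1 A c b uP (leqnn M).
have [s1 _] := rat_near0 (fun j => creation R 1 M j + (creation R 1 M j)^T) an.
have [s2 _] := lim0_fock_tuple 1 M Am (desJ_unit r).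
apply: (@tensmx1_inj _ _ _ _ _ 0); apply: lim0_uniq l1 _.
apply: lim0_eq l2; apply: small_impl (small_and s1 s2) => t _ [ev u].
have N0 : (0 < fock_dim g 1 M)%N.
  by rewrite /fock_dim; apply/card_gt0P; exists (None, ord0).
have [S hS e] := h _ _ ev.
have := eq _ N0 (fock_tuple 1 M t) (conj (fock_tuple_sym _ _ _) ev) (conj (fock_tuple_sym _ _
    _) u).
move=> e2; move: e; rewrite [rat_eval _ _]e2 /des_eval tensmxNl addrAC subrr add0r => ->.
have [v _] := mulmx1_unit hS.
by rewrite -[S](mulKmx v) hS mulmx1.
Qed.

Lemma mulmx_spanned_eq0 n k (Q : 'M[R]_(k, d * n)) :
  minimal r -> (forall w, Q *m ((moment J Am w *m C) *t 1%:M) = 0) -> Q = 0.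
Proof.
move=> /minimal_spanned[s e] h.
rewrite -[LHS]mulmx1 -tensmx11 -e tensmx_suml mulmx_sumr big1 // => p _.
by rewrite -[1%:M]mulmx1 -tensmx_mul mulmxA h mul0mx.
Qed.

(** Observability is the transpose of controllability: the realization is symmetric, and transposing
    a moment reverses its word. *)
Lemma spanned_mulmx_eq0 n k (Q : 'M[R]_(d * n, k)) :
  minimal r -> (forall w, ((C^T *m moment J Am w) *t 1%:M) *m Q = 0) -> Q = 0.
Proof.
move=> hmin h; apply: trmx_inj; rewrite trmx0; apply: mulmx_spanned_eq0 => // w.
apply: trmx_inj; rewrite trmx0 trmx_mul trmxK trmx_tens trmx1 trmx_mul moment_tr.
exact: h.
Qed.

Lemma pencil_factor m n (P : 'M[R]_m) (A : mxtuple R g m) (X : mxtuple R g n) :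
  P \in unitmx ->
  pencil P A X = (P *t 1%:M) *m (1%:M - \sum_j (invmx P *m A j) *t X j).
Proof.
move=> uP; rewrite mulmxBr mulmx1 mulmx_sumr; congr (_ - _).
by apply: eq_bigr => j _; rewrite tensmx_mul mul1mx mulKVmx.
Qed.

(** Letting one factor of the power act on the moment lengthens its word by a letter, while
    [1 *t X j] moves to the right end; this drives an induction on the power. *)
Lemma tens_moment_pow m n k (P : 'M[R]_m) (A : mxtuple R g m) (b : 'M[R]_(m, l)) (X : mxtuple
    R g n) w :
  iter k.+1 (fun B => B *m (\sum_j (invmx P *m A j) *t X j)) 1%:M *m ((moment P A w *m b) *t
      1%:M) =
  \sum_j iter k (fun B => B *m (\sum_j (invmx P *m A j) *t X j)) 1%:M *m
     ((moment P A (j :: w) *m b) *t 1%:M) *m (1%:M *t X j).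
Proof.
rewrite iterS -mulmxA mulmx_suml mulmx_sumr; apply: eq_bigr => j _.
rewrite -mulmxA; congr (_ *m _).
by rewrite !tensmx_mul mul1mx !mulmx1 /moment word_eval_cons !mulmxA.
Qed.

Lemma moment_cat m (P : 'M[R]_m) (A : mxtuple R g m) u v :
  P \in unitmx -> moment P A u *m (P *m moment P A v) = moment P A (u ++ v).
Proof.
by move=> uP; rewrite /moment word_eval_cat -!mulmxA; congr (_ *m _); rewrite mulKmx.
Qed.

(* The characteristic polynomial of the second pencil annihilates the first. *)
Lemma unitmx_transfer m n (P : 'M[R]_m) (A : mxtuple R g m) (c : 'M[R]_(l, m)) (b : 'M[R]_(m,
    l))
    (X : mxtuple R g n) :
  minimal r -> P \in unitmx ->
  (forall w, C^T *m moment J Am w *m C = c *m moment P A w *m b) ->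
  pencil P A X \in unitmx -> pencil J Am X \in unitmx.
Proof.
move=> hmin uP hm; rewrite !pencil_factor ?desJ_unit //.
set L := \sum_j _; set L' := \sum_j _ => hu.
have [uP1 _] := tensmx_inv n uP; have [uJ1 _] := tensmx_inv n (desJ_unit r).
rewrite unitmx_mul uP1 /= in hu; rewrite unitmx_mul uJ1 /=.
have [q q1 qL] := annihilating_poly L.
(* Between two moments a power of [L'] expands into moments of longer words and products of the
   [X j], so equal moments give equal compressions for the two pencils. *)
have key k v w :
    ((C^T *m moment J Am v) *t 1%:M) *m ((J *t 1%:M) *m
      (iter k (fun B => B *m L') 1%:M *m ((moment J Am w *m C) *t 1%:M))) =
    ((c *m moment P A v) *t 1%:M) *m ((P *t 1%:M) *m
      (iter k (fun B => B *m L) 1%:M *m ((moment P A w *m b) *t 1%:M))).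
  elim: k w => [|k IH] w.
    rewrite !mul1mx !tensmx_mul !mulmx1; congr (_ *t _).
    have := hm (v ++ w); rewrite -!moment_cat ?desJ_unit // => e.
    by move: e; rewrite !mulmxA.
  rewrite !tens_moment_pow !mulmx_sumr; apply: eq_bigr => j _.
  by rewrite !mulmxA -[in LHS]mulmxA -!mulmxA; move: (IH (j :: w)); rewrite !mulmxA => ->.
have qL' : \sum_(i < size q) q`_i *: iter i (fun B => B *m L') 1%:M = 0.
  apply: mulmx_spanned_eq0 => // w; rewrite -[LHS](mulKmx uJ1).
  rewrite [X in _ *m X](_ : _ = 0) ?mulmx0 //.
  apply: spanned_mulmx_eq0 => // v.
  rewrite mulmx_suml !mulmx_sumr.
  transitivity (((c *m moment P A v) *t 1%:M) *m ((P *t 1%:M) *m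
      ((\sum_(i < size q) q`_i *: iter i (fun B => B *m L) 1%:M) *m ((moment P A w *m b) *t
          1%:M)))).
    rewrite mulmx_suml !mulmx_sumr; apply: eq_bigr => i _.
    by rewrite -!scalemxAl -!scalemxAr key.
  by rewrite qL mul0mx !mulmx0.
(* A kernel vector [x] is fixed by [L'], so [q(L') = 0] gives [q(1) x = 0], and [q(1)] is the
   nonzero [\det (1 - L)]. *)
apply: unitmx_inj => x; rewrite mulmxBl mul1mx => /eqP; rewrite subr_eq0 => /eqP ex.
have pw k : iter k (fun B => B *m L') 1%:M *m x = x.
  by elim: k => [|k IH]; rewrite ?mul1mx // iterS -mulmxA -ex.
have : q.[1] *: x = 0.
  have := congr1 (mulmx^~ x) qL'; rewrite mul0mx mulmx_suml => <-.
  rewrite horner_coef scaler_suml; apply: eq_bigr => i _.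
  by rewrite expr1n mulr1 -scalemxAl pw.
move/eqP; rewrite scalemx_eq0 q1 => /orP[/eqP d0|/eqP //].
by move: hu; rewrite unitmxE d0 unitr0.
Qed.

Lemma domalg_des_dom n : minimal r -> (domalg r n `<=` des_dom r n)%classic.
Proof.
move=> hmin X [s [an eq] dX]; split; first by case: dX.
have [m [P [A [c [b [uP hX hm]]]]]] := equiv_moment an eq.
exact: unitmx_transfer hmin uP hm (hX n X dX).
Qed.

End Alg.

(** * Positive definite matrices *)

Section Posdef.
Variable R : realType.

Definition quad m (M : 'M[R]_m) (v : 'cV[R]_m) : R := (v^T *m M *m v) 0 0.

Lemma quadD m (M N : 'M[R]_m) v : quad (M + N) v = quad M v + quad N v.
Proof. by rewrite /quad mulmxDr mulmxDl mxE. Qed.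

Lemma posdef_ge0 m (M : 'M[R]_m) v : posdef M -> 0 <= quad M v.
Proof.
move=> [_ h]; have [->|v0] := eqVneq v 0; first by rewrite /quad mulmx0 mxE.
exact/ltW/h.
Qed.

Lemma posdef_unit m (M : 'M[R]_m) : posdef M -> M \in unitmx.
Proof.
move=> [_ h]; apply: unitmx_inj => x e; apply/eqP/negPn/negP => x0.
by have := h x x0; rewrite -mulmxA e mulmx0 mxE ltxx.
Qed.

(* Cauchy-Schwarz for the form of [M], applied to [v] and [invmx M *m e_i]. *)
Lemma posdef_coord m (M : 'M[R]_m) i (v : 'cV[R]_m) :
  posdef M -> v i 0 ^+ 2 <= (invmx M) i i * quad M v.
Proof.
move=> pM; have uM := posdef_unit pM; have [sM hM] := pM.
pose e : 'cV[R]_m := delta_mx i 0; pose a := invmx M *m e.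
have aM : a^T *m M = e^T by rewrite trmx_mul trmx_inv sM mulmxKV.
have Ma : M *m a = e by rewrite mulKVmx.
have ex (x : 'cV[R]_m) : (e^T *m x) 0 0 = x i 0.
  by rewrite trmx_delta -rowE mxE.
have xe (x : 'cV[R]_m) : (x^T *m e) 0 0 = x i 0.
  by rewrite -ex -[in RHS](trmxK x) -trmx_mul [RHS]mxE.
have al : a i 0 = invmx M i i by rewrite /a -colE mxE.
have a0 : a != 0.
  apply/eqP => a0; move: Ma; rewrite a0 mulmx0 => /matrixP/(_ i 0)/eqP.
  by rewrite !mxE !eqxx eq_sym oner_eq0.
have al0 : 0 < invmx M i i.
  by have := hM a a0; rewrite aM ex al.
pose s := v i 0 / invmx M i i.
have : 0 <= quad M (v - s *: a) by exact: posdef_ge0.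
have -> : quad M (v - s *: a) = quad M v - 2 * s * v i 0 + s ^+ 2 * invmx M i i.
  have e1 : (v^T *m M *m a) 0 0 = v i 0 by rewrite -mulmxA Ma xe.
  have e2 : (a^T *m M *m v) 0 0 = v i 0 by rewrite aM ex.
  have e3 : (a^T *m M *m a) 0 0 = invmx M i i by rewrite aM ex.
  have eT : (v - s *: a)^T = v^T - s *: a^T by apply/matrixP => ? ?; rewrite !mxE.
  rewrite /quad eT mulmxBl mulmxBl !mulmxBr -!scalemxAl -!scalemxAr.
  have sub (x y : 'M[R]_1) : (x - y) 0 0 = x 0 0 - y 0 0 by rewrite !mxE.
  have sc c (x : 'M[R]_1) : (c *: x) 0 0 = c * x 0 0 by rewrite mxE.
  by rewrite !(sub, sc) e1 e2 e3; ring.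
have -> : quad M v - 2 * s * v i 0 + s ^+ 2 * invmx M i i = quad M v - v i 0 ^+ 2 / invmx M i i.
  by rewrite /s; field; apply: lt0r_neq0.
by rewrite subr_ge0 ler_pdivrMr // mulrC.
Qed.

Lemma quad_le m (E : 'M[R]_m) (v : 'cV[R]_m) :
  `|quad E v| <= l1 E * \sum_i v i 0 ^+ 2.
Proof.
have h i j : `|v i 0| * `|v j 0| <= \sum_k v k 0 ^+ 2.
  have hk k : v k 0 ^+ 2 <= \sum_k v k 0 ^+ 2.
    by rewrite (bigD1 k) //= lerDl sumr_ge0 // => ? _; apply: sqr_ge0.
  have := hk i; have := hk j; rewrite -(real_normK (num_real (v i 0))) -(real_normK (num_real
      (v j 0))).
  have := sqr_ge0 (`|v i 0| - `|v j 0|); rewrite sqrrB; lra.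
have -> : quad E v = \sum_j \sum_i v i 0 * E i j * v j 0.
  rewrite /quad mxE; apply: eq_bigr => j _; rewrite mxE mulr_suml.
  by apply: eq_bigr => i _; rewrite mxE.
rewrite exchange_big /l1 /= mulr_suml; apply: le_trans (ler_norm_sum _ _ _) _; apply: ler_sum
    => i _.
rewrite mulr_suml; apply: le_trans (ler_norm_sum _ _ _) _; apply: ler_sum => j _.
by rewrite !normrM mulrAC mulrC ler_wpM2l.
Qed.

(** By [posdef_coord], [K * quad M v] bounds the squared length of [v], so a perturbation of norm at
    most [1 / (2 (K + 1))] changes the form by at most half of its value. *)
Lemma posdef_open m (M : 'M[R]_m) :
  posdef M -> exists2 e, 0 < e & forall M', M'^T = M' -> l1 (M' - M) <= e -> posdef M'.
Proof.
move=> pM; pose K := \sum_i `|invmx M i i|.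
have K0 : 0 <= K by apply: sumr_ge0.
have hK (v : 'cV[R]_m) : \sum_i v i 0 ^+ 2 <= K * quad M v.
  rewrite /K mulr_suml; apply: ler_sum => i _.
  apply: le_trans (posdef_coord i v pM) _.
  by rewrite ler_wpM2r ?ler_norm // posdef_ge0.
exists (2 * (K + 1))^-1; first by rewrite invr_gt0 mulr_gt0 // ltr_wpDl.
move=> M' sM' hM'; split=> // v v0; rewrite -/(quad M' v).
have -> : M' = M + (M' - M) by rewrite addrC subrK.
rewrite quadD.
have q0 : 0 < quad M v by case: pM => _; apply.
suff : `|quad (M' - M) v| <= 2^-1 * quad M v by rewrite ler_norml => /andP[]; lra.
apply: le_trans (quad_le _ _) _.
apply: (@le_trans _ _ ((2 * (K + 1))^-1 * (K * quad M v))).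
  by apply: ler_pM; rewrite ?l1_ge0 // sumr_ge0 // => i _; apply: sqr_ge0.
rewrite mulrA ler_wpM2r ?(ltW q0) // mulrC ler_pdivrMr ?mulr_gt0 ?ltr_wpDl //.
lra.
Qed.

Lemma sum_mxtens m n (F : 'I_(m * n) -> R) :
  \sum_k F k = \sum_i \sum_j F (mxtens_index (i, j)).
Proof.
rewrite pair_big /=; rewrite (reindex (@mxtens_index m n)) /=.
  by apply: eq_bigr => -[].
by exists (@mxtens_unindex m n) => i _; rewrite (mxtens_indexK, mxtens_unindexK).
Qed.

Lemma posdef_tens1 m n (Q : 'M[R]_m) : posdef Q -> posdef (Q *t (1%:M : 'M[R]_n)).
Proof.
move=> pQ; have [sQ hQ] := pQ; split; first by rewrite trmx_tens sQ trmx1.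
move=> v v0; pose s i : 'cV[R]_m := \col_a v (mxtens_index (a, i)) 0.
have -> : (v^T *m (Q *t 1%:M) *m v) 0 0 = \sum_i quad Q (s i).
  rewrite -mulmxA mxE sum_mxtens exchange_big; apply: eq_bigr => i _.
  rewrite /quad -mulmxA mxE; apply: eq_bigr => a _; rewrite mxE; congr (_ * _).
    by rewrite !mxE.
  rewrite !mxE sum_mxtens; apply: eq_bigr => b _.
  rewrite (bigD1 i) //= big1 => [|j ji].
    by rewrite tensmxE !mxE eqxx mulr1 addr0.
  by rewrite tensmxE !mxE eq_sym (negbTE ji) mulr0 mul0r.
have [i si] : exists i, s i != 0.
  apply/existsP; apply: contraNT v0 => /existsPn h.
  apply/eqP/matrixP => k z; rewrite (ord1 z) mxE; case: (mxtens_indexP k) => a i.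
  by have /negPn/eqP/matrixP/(_ a 0) := h i; rewrite !mxE.
rewrite (bigD1 i) //=; apply: ltr_pwDl; first exact: hQ.
by apply: sumr_ge0 => j _; exact: posdef_ge0.
Qed.

(** The range of [i] reduces [EY], which acts there as [E0]. Replacing that block by [EX] leaves the
    sum of the form of [EX] on the range and the form of [EY] on its complement. *)
Lemma posdef_dsum p q (EY : 'M[R]_p) (EX E0 : 'M[R]_q) (i : 'M[R]_(p, q)) :
  i^T *m i = 1%:M -> i^T *m EY = E0 *m i^T -> posdef EY -> posdef EX -> E0^T = E0 ->
  posdef (EY + i *m (EX - E0) *m i^T).
Proof.
move=> ii iE pY pX s0; have [sY hY] := pY; have [sX hX] := pX.
have Ei : EY *m i = i *m E0 by apply: trmx_inj; rewrite !trmx_mul sY s0.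
split.
  by rewrite linearD /= sY !trmx_mul trmxK linearB /= sX s0 mulmxA.
move=> v v0; pose a := i^T *m v; have [w ew] : {w | w = v - i *m a} by exists (v - i *m a).
have iw : i^T *m w = 0 by rewrite ew mulmxBr mulmxA ii mul1mx subrr.
have wi : w^T *m i = 0 by apply: trmx_inj; rewrite trmx_mul trmxK trmx0.
have ev : v = i *m a + w by rewrite ew addrC subrK.
have -> : v^T *m (EY + i *m (EX - E0) *m i^T) *m v = a^T *m EX *m a + w^T *m EY *m w.
  rewrite mulmxDr mulmxDl.
  have -> : v^T *m (i *m (EX - E0) *m i^T) *m v = a^T *m (EX - E0) *m a.
    by rewrite /a trmx_mul trmxK !mulmxA.
  have -> : v^T *m EY *m v = a^T *m E0 *m a + w^T *m EY *m w.
    have evT : v^T = a^T *m i^T + w^T by rewrite -trmx_mul -linearD /= -ev.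
    have -> : v^T *m EY *m v = (a^T *m i^T + w^T) *m EY *m (i *m a + w).
      by rewrite -evT -ev.
    rewrite (mulmxDl _ _ EY) -(mulmxA a^T) iE mulmxDl !mulmxDr.
    rewrite (mulmxA _ i a) (mulmxA _ i a) -(mulmxA w^T EY i) Ei (mulmxA w^T i) wi !mul0mx add0r.
    by rewrite -!(mulmxA a^T) -!(mulmxA E0) ii iw !mulmx0 addr0 mul1mx.
  by rewrite mulmxBr mulmxBl addrC addrA subrK.
rewrite mxE; have [a0|a0] := eqVneq a 0.
  rewrite a0 mulmx0 [X in X + _]mxE add0r; apply: hY.
  by move: v0; rewrite ev a0 mulmx0 add0r.
by apply: ltr_pwDl; [exact: hX | exact: posdef_ge0].
Qed.

End Posdef.

(** * Coupling a point to a Fock-space tuple *)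

Section Schur.
Variables (R : realType) (p q : nat).
Variables (Q : 'M[R]_p) (J' L : 'M[R]_q) (i e : 'M[R]_(p, q)).
Hypotheses (ii : i^T *m i = 1%:M) (ie : i^T *m e = 0).
Hypotheses (iQ : i^T *m Q = J' *m i^T) (Qi : Q *m i = i *m J').
Hypotheses (uQ : Q \in unitmx) (uJ : J' \in unitmx) (uX : J' - L \in unitmx).
Local Notation S := (invmx (J' - L)).
Local Notation Pi := (1%:M - i *m i^T).

(** [Q] plays the pencil of a Fock-space tuple and [J'] its block at the isolated vertex, embedded
    by [i]. A point with linear part [L] is placed there and joined to the block of [e] with
    strength [t]. *)
Definition coupled t := Q - i *m L *m i^T - t *: (i *m L *m e^T + e *m L *m i^T).

Let ei : e^T *m i = 0. Proof. by apply: trmx_inj; rewrite trmx_mul trmxK ie trmx0. Qed.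

Lemma corner_invl : i^T *m invmx Q = invmx J' *m i^T.
Proof. by rewrite -[RHS](mulmxK uQ) -(mulmxA _ i^T) iQ mulKmx. Qed.

Lemma corner_invr : invmx Q *m i = i *m invmx J'.
Proof. by rewrite -[RHS](mulKmx uQ) (mulmxA Q) Qi mulmxK. Qed.

Lemma coupled0_inv :
  coupled 0 *m (invmx Q + i *m (S - invmx J') *m i^T) = 1%:M.
Proof.
set D := S - _.
have a1 : Q *m (i *m D *m i^T) = i *m (J' *m D) *m i^T by rewrite !mulmxA Qi.
have a2 : i *m L *m i^T *m invmx Q = i *m (L *m invmx J') *m i^T.
  by rewrite -(mulmxA (i *m L)) corner_invl !mulmxA.
have a3 : i *m L *m i^T *m (i *m D *m i^T) = i *m (L *m D) *m i^T.
  by rewrite -!mulmxA (mulmxA i^T i) ii mul1mx.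
have a4 : J' *m D = L *m invmx J' + L *m D.
  apply/eqP; rewrite -subr_eq -mulmxBl mulmxBr mulmxV // mulmxBl mulmxV //.
  by rewrite opprB addrC subrK.
clearbody D; rewrite /coupled scale0r subr0 mulmxBl !mulmxDr mulmxV // a1 a2 a3 a4.
by rewrite mulmxDr mulmxDl addrK.
Qed.

(** Eliminating the block of [i] perturbs [Q] on the complement by [- t^2 L S L] at the block of
    [e]; the formula is the resolvent identity for this perturbation. *)
Lemma schur_block t (uP : coupled t \in unitmx) :
  Pi *m (invmx (coupled t) - invmx Q) *m Pi =
  invmx Q *m e *m (t ^+ 2 *: (L *m S *m L)) *m (e^T *m invmx (coupled t) *m Pi).
Proof.
set G := invmx _.
have iPi : i^T *m Pi = 0 by rewrite mulmxBr mulmx1 mulmxA ii mul1mx subrr.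
have Pii : Pi *m i = 0 by rewrite mulmxBl mul1mx -mulmxA ii mulmx1 subrr.
have hQe : Pi *m (invmx Q *m e) = invmx Q *m e.
  by rewrite mulmxBl mul1mx -(mulmxA i) (mulmxA i^T) corner_invl -(mulmxA _ i^T) ie !mulmx0
      subr0.
have hQi : Pi *m (invmx Q *m i) = 0 by rewrite corner_invr mulmxA Pii mul0mx.
set PP := 1%:M - _ in iPi Pii hQe hQi *; clearbody PP.
(* Block row [i] of [coupled t *m G = 1], solved with [S]; the right side dies against the
   projection. *)
have h1 : i^T *m G *m PP = t *: (S *m L *m e^T *m G *m PP).
  have hP : i^T *m coupled t = (J' - L) *m i^T - t *: (L *m e^T).
    rewrite /coupled !mulmxBr iQ -scalemxAr mulmxDr !mulmxA ii ie !mul0mx !mul1mx addr0.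
    by rewrite mulmxBl.
  have : i^T *m coupled t *m G = i^T by rewrite mulmxK.
  rewrite hP mulmxBl => /eqP; rewrite subr_eq => /eqP/(congr1 (fun M => S *m M *m PP)).
  rewrite !mulmxA mulVmx // mul1mx => ->.
  rewrite mulmxDr mulmxDl -(mulmxA S) iPi mulmx0 add0r -scalemxAl -!scalemxAr -scalemxAl.
  by rewrite !mulmxA.
have h2 : G - invmx Q = invmx Q *m (Q - coupled t) *m G.
  by rewrite mulmxBr mulVmx // mulmxBl mul1mx mulmxK.
have eD : Q - coupled t = i *m (L *m i^T + t *: (L *m e^T)) + t *: (e *m L *m i^T).
  by rewrite /coupled -addrA -opprD subKr scalerDr addrA mulmxDr -scalemxAr !mulmxA.
set X := _ + t *: (L *m e^T) in eD; clearbody X.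
have e1 : PP *m (invmx Q *m (i *m X)) = 0 by rewrite (mulmxA _ i) (mulmxA PP) hQi mul0mx.
have e2 : PP *m (invmx Q *m (e *m L *m i^T)) = invmx Q *m e *m L *m i^T.
  by rewrite -!(mulmxA e) (mulmxA _ e) (mulmxA PP) hQe !mulmxA.
rewrite h2 -(mulmxA (invmx Q)) (mulmxA PP) -(mulmxA _ (_ *m G)) mulmxA.
rewrite eD; set W := _ *m PP.
transitivity (PP *m (invmx Q *m (i *m X + t *: (e *m L *m i^T))) *m (G *m PP)).
  by rewrite /W !mulmxA.
rewrite !mulmxDr e1 add0r -!scalemxAr e2 -scalemxAl -!mulmxA (mulmxA i^T) h1.
by rewrite -!scalemxAr scalerA -expr2 -!scalemxAl !mulmxA.
Qed.

(** With [U] for [t^2 L S L] and [kap] for [e^T Q^-1 e], the left inverse [k] turns the Schur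
    formula into [Theta = U + U kap Theta]. A small [Theta] makes the last term at most half of [U]
    in norm, so it can be absorbed. *)
Lemma schur_bound m (Cc : 'M[R]_(p, m)) (k : 'M[R]_(q, m)) t :
  Q^T = Q -> k *m (Cc^T *m invmx Q *m e) = 1%:M -> coupled t \in unitmx ->
  let Theta := k *m (Cc^T *m (Pi *m (invmx (coupled t) - invmx Q) *m Pi) *m Cc) *m k^T in
  l1 Theta * (l1 (e^T *m invmx Q *m e) + 1) <= 2^-1 ->
  l1 (t ^+ 2 *: (L *m S *m L)) <= 1.
Proof.
move=> sQ kc uP Theta hT.
have sb := schur_block uP; set U := t ^+ 2 *: _ in sb *; set V := e^T *m _ *m Pi in sb.
set kap := e^T *m _ *m e in hT.
have ePi : e^T *m Pi = e^T by rewrite mulmxBr mulmx1 mulmxA ei mul0mx subr0.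
have eQPi : e^T *m invmx Q *m Pi = e^T *m invmx Q.
  by rewrite mulmxBr mulmx1 -!mulmxA (mulmxA _ i) corner_invr !mulmxA ei !mul0mx subr0.
have hV : V = e^T *m invmx Q + kap *m U *m V.
  have : e^T *m (Pi *m (invmx (coupled t) - invmx Q) *m Pi) = kap *m U *m V.
    by rewrite sb !mulmxA.
  rewrite !mulmxA ePi (mulmxBr e^T) mulmxBl eQPi => /eqP; rewrite subr_eq => /eqP.
  by rewrite -/V addrC.
have kD : k *m (Cc^T *m (Pi *m (invmx (coupled t) - invmx Q) *m Pi) *m Cc) = U *m (V *m Cc).
  rewrite sb; transitivity ((k *m (Cc^T *m invmx Q *m e)) *m (U *m (V *m Cc))).
    by rewrite !mulmxA.
  by rewrite kc mul1mx.
have kcT : (e^T *m invmx Q *m Cc) *m k^T = 1%:M.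
  by apply: trmx_inj; rewrite !trmx_mul !trmxK trmx_inv sQ trmx1 -kc !mulmxA.
have eU : U = Theta - U *m kap *m Theta.
  have e1 : Theta = U + U *m kap *m Theta.
    rewrite /Theta kD {1}hV (mulmxDl _ _ Cc) mulmxDr mulmxDl -(mulmxA U _ k^T) kcT mulmx1.
    by rewrite !mulmxA.
  by rewrite {1}e1 addrK.
have b : l1 U <= l1 Theta + l1 U * l1 kap * l1 Theta.
  rewrite {1}eU (le_trans (l1D _ _)) // lerD2l l1N (le_trans (l1M _ _)) //.
  by rewrite ler_wpM2r ?l1_ge0 // l1M.
have T0 := l1_ge0 Theta; have U0 := l1_ge0 U; have K0 := l1_ge0 kap.
have h1 : l1 Theta <= 2^-1 by nra.
have h2 : l1 kap * l1 Theta <= 2^-1 by nra.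
have : l1 U * l1 kap * l1 Theta <= l1 U * 2^-1 by rewrite -mulrA ler_wpM2l.
lra.
Qed.

End Schur.

(** * Left-invertible columns from minimality *)

Section LeftInverse.
Variables (R : realType) (g d l : nat) (r : descriptor R g d l).
Local Notation J := (desJ r).
Local Notation Am := (desA r).
Local Notation C := (desC r).

(** Minimality expands the identity in moments, which are the leading entries of the column at the
    empty word. The same combination of entries tends to the identity, hence is invertible for small
    [t]. *)
Lemma fock_left_inverse n : minimal r -> exists M, small (fun t =>
  exists k : 'M[R]_(d * n, l * fock_dim g n M),
    k *m ((C *t 1%:M)^T *m invmx (pencil J Am (fock_tuple n M t)) *m
          (1%:M *t word_emb R n M [::])) = 1%:M).
Proof.
(* [M] is the length of the longest word in the expansion, so that none of its entries is
   truncated. *)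
move=> /minimal_spanned[s es]; pose M := \max_(p <- s) size p.1.
have hM p : p \in s -> (size p.1 <= M)%N by move=> ps; exact: leq_bigmax_seq.
exists M.
have [u1 l1] := lim0_fock_tilted n M Am (desJ_unit r).
have [u2 _] := lim0_fock_tuple n M Am (desJ_unit r).
pose H w t := (1%:M *t (word_emb R n M w)^T) *m
  (invmx (pencil J Am (fock_tilted n M t)) *m (1%:M *t @word_emb R g n M [::])).
pose H0 w := (1%:M *t (word_emb R n M w)^T) *m
  (invmx (pencil J Am (creation R n M)) *m (1%:M *t @word_emb R g n M [::])).
have lF : lim0 (fun t => \sum_(p <- s) ((p.2^T *m C^T) *t 1%:M) *m H (rev p.1) t) 1%:M.
  have -> : 1%:M = \sum_(p <- s) ((p.2^T *m C^T) *t (1%:M : 'M[R]_n)) *m H0 (rev p.1).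
    rewrite -tensmx11 -[X in X *t _]trmx1 -es linear_sum /= tensmx_suml big_seq [RHS]big_seq.
    apply: eq_bigr => p ps; rewrite /H0 pencil_creation_col ?size_rev ?hM // ?desJ_unit //.
    by rewrite tensmx_mul mulmx1 trmx_mul trmx_mul moment_tr mulmxA.
  apply: lim0_sum => p; apply: lim0M (lim0_cst _) _.
  by apply: lim0M (lim0_cst _) _; exact: lim0M l1 (lim0_cst _).
have [u3 _] := lim0V (unitmx1 _ _) lF.
apply: small_impl (small_and (small_and u1 u2) u3) => t t0 [[v1 v2] v3].
set F := \sum_(p <- s) _ in v3.
exists (invmx F *m \sum_(p <- s) t ^- size p.1 *: (p.2^T *t (word_emb R n M (rev p.1))^T)).
rewrite -(mulmxA (invmx F)) -[RHS](mulVmx v3); congr (_ *m _).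
rewrite mulmx_suml; apply: eq_bigr => p _.
have := fock_col (rev p.1) v1 v2; rewrite -/(H _ t) => e.
have -> : p.2^T *t (word_emb R n M (rev p.1))^T = (p.2^T *t 1%:M) *m (1%:M *t (word_emb R n M
    (rev p.1))^T).
  by rewrite tensmx_mul mulmx1 mul1mx.
rewrite -scalemxAl trmx_tens trmx1 -!mulmxA.
rewrite (mulmxA _ (C^T *t 1%:M)) tensmx_mul mul1mx mulmx1.
have -> : C^T *t (word_emb R n M (rev p.1))^T = (C^T *t 1%:M) *m (1%:M *t (word_emb R n M
    (rev p.1))^T).
  by rewrite tensmx_mul mulmx1 mul1mx.
rewrite -mulmxA e size_rev -!scalemxAr scalerA mulVf ?scale1r.
  by rewrite mulmxA tensmx_mul mulmx1.
by rewrite expf_neq0 // lt0r_neq0.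
Qed.

End LeftInverse.

(** * The descriptor on direct sums and their couplings *)

Section Lim.
Variables (R : realType) (g d l : nat) (r : descriptor R g d l).
Local Notation J := (desJ r).
Local Notation Am := (desA r).
Local Notation C := (desC r).
Local Notation D := (desD r).

Lemma desD_sym : posdef (des_val0 r) -> D^T = D.
Proof.
move=> [+ _]; rewrite /des_val0 linearD /= !trmx_mul trmxK desJ_sym mulmxA.
exact: addIr.
Qed.

Lemma des_pencil_sym n (X : mxtuple R g n) : symtuple X -> (des_pencil r X)^T = des_pencil r X.
Proof.
move=> sX; rewrite /des_pencil linearB /= trmx_tens desJ_sym trmx1 linear_sum /=.
by congr (_ - _); apply: eq_bigr => j _; rewrite trmx_tens desA_sym sX.
Qed.

Lemma des_eval_sym n (X : mxtuple R g n) :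
  posdef (des_val0 r) -> symtuple X -> (des_eval r n X)^T = des_eval r n X.
Proof.
move=> hpos sX; rewrite /des_eval linearD /= trmx_tens desD_sym // trmx1; congr (_ + _).
by rewrite !trmx_mul trmx_inv des_pencil_sym // !trmx_tens !trmxK !trmx1 mulmxA.
Qed.

Lemma des_evalE n (X : mxtuple R g n) : des_eval r n X =
  D *t 1%:M + (C *t 1%:M)^T *m invmx (pencil J Am X) *m (C *t 1%:M).
Proof. by rewrite trmx_tens trmx1. Qed.

Section Couple.
Variables (n M : nat).
Local Notation Ni := (none_emb R g n M).
Local Notation Ne := (@word_emb R g n M [::]).
Local Notation ih := ((1%:M : 'M[R]_d) *t Ni).
Local Notation eh := ((1%:M : 'M[R]_d) *t Ne).
Local Notation il := ((1%:M : 'M[R]_l) *t Ni).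
Local Notation J1 := (J *t (1%:M : 'M[R]_n)).
Local Notation Q t := (pencil J Am (fock_tuple n M t)).

(** For [u = 0], the direct sum of [X], at the isolated vertex, and the Fock-space tuple; [u] weighs
    an off-diagonal copy of [X] between that vertex and the empty word. *)
Definition coupled_tuple t (X : mxtuple R g n) u : mxtuple R g (fock_dim g n M) :=
  fun j => Ni *m X j *m Ni^T + u *: (Ni *m X j *m Ne^T + Ne *m X j *m Ni^T) + fock_tuple n M
      t j.

Definition lin_part (X : mxtuple R g n) : 'M[R]_(d * n) := \sum_j Am j *t X j.

Lemma coupled_tuple_sym t X u : symtuple X -> symtuple (coupled_tuple t X u).
Proof.
move=> sX j; rewrite /coupled_tuple 2!linearD linearZ linearD /= !trmx_mul !trmxK sX !mulmxA.
by rewrite [(fock_tuple _ _ _ _)^T]fock_tuple_sym [_ *m _ *m Ne^T + _]addrC.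
Qed.

Lemma pencil_coupled_tuple t X u :
  pencil J Am (coupled_tuple t X u) = coupled (Q t) (lin_part X) ih eh u.
Proof.
have e (U V : 'M[R]_(fock_dim g n M, n)) :
    (1%:M *t U) *m lin_part X *m (1%:M *t V)^T = \sum_j Am j *t (U *m X j *m V^T).
  rewrite trmx_tens trmx1 mulmx_sumr mulmx_suml; apply: eq_bigr => j _.
  by rewrite !tensmx_mul mul1mx mulmx1.
rewrite /coupled !e -big_split scaler_sumr /= /pencil -addrA -opprD -addrA -opprD; congr (_ -
    _).
rewrite addrC -addrA -!big_split /=; apply: eq_bigr => j _.
by rewrite /coupled_tuple !tensmxDr tensmxZr tensmxDr addrA.
Qed.

Lemma ih_ih : ih^T *m ih = 1%:M.
Proof. by rewrite trmx_tens trmx1 tensmx_mul none_emb_ortho mulmx1 tensmx11. Qed.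

Lemma il_il : il^T *m il = 1%:M.
Proof. by rewrite trmx_tens trmx1 tensmx_mul none_emb_ortho mulmx1 tensmx11. Qed.

Lemma ih_eh : ih^T *m eh = 0.
Proof. by rewrite trmx_tens trmx1 tensmx_mul none_word_ortho tensmx0. Qed.

Lemma none_emb_fock_tuple t j : Ni^T *m fock_tuple n M t j = 0.
Proof.
rewrite /fock_tuple -scalemxAr mulmxDr none_emb_creation add0r.
by rewrite -[Ni^T *m _]trmxK trmx_mul !trmxK creation_none_emb trmx0 scaler0.
Qed.

Lemma ih_Q t : ih^T *m Q t = J1 *m ih^T.
Proof.
rewrite trmx_tens trmx1 mul_pencil big1 => [|j _]; last by rewrite none_emb_fock_tuple tensmx0.
by rewrite subr0 tensmx_mul mulmx1 mul1mx.
Qed.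

Lemma Q_sym t : (Q t)^T = Q t.
Proof. by apply: (@des_pencil_sym _ (fock_tuple n M t)); exact: fock_tuple_sym. Qed.

Lemma J1_sym : J1^T = J1.
Proof. by rewrite trmx_tens desJ_sym trmx1. Qed.

Lemma Q_ih t : Q t *m ih = ih *m J1.
Proof. by apply: trmx_inj; rewrite !trmx_mul Q_sym ih_Q J1_sym. Qed.

Lemma J1_unit : J1 \in unitmx.
Proof. by case: (tensmx_inv n (desJ_unit r)). Qed.

Lemma des_val0E : des_val0 r *t (1%:M : 'M[R]_n) =
  D *t 1%:M + (C *t 1%:M)^T *m invmx J1 *m (C *t 1%:M).
Proof.
rewrite tensmxDl; congr (_ + _).
have [_ ->] := tensmx_inv n (desJ_unit r).
by rewrite desJ_inv trmx_tens trmx1 !tensmx_mul !mulmx1.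
Qed.

Lemma C_ih : (C *t 1%:M)^T *m ih = il *m (C *t 1%:M)^T.
Proof. by rewrite !trmx_tens trmx1 !tensmx_mul !mulmx1 trmx1 !mul1mx mulmx1. Qed.

Lemma ihT_C : ih^T *m (C *t 1%:M) = (C *t 1%:M) *m il^T.
Proof. by apply: trmx_inj; rewrite !trmx_mul !trmxK C_ih. Qed.

Lemma ilT_CT : il^T *m (C *t 1%:M)^T = (C *t 1%:M)^T *m ih^T.
Proof. by rewrite !trmx_tens !trmx1 !tensmx_mul !mulmx1 !mul1mx. Qed.

Lemma direct_sum_dom t X :
  Q t \in unitmx -> des_dom r n X -> des_dom r (fock_dim g n M) (coupled_tuple t X 0).
Proof.
move=> uQ [sX uX]; split; first exact: coupled_tuple_sym.
have := coupled0_inv eh ih_ih (ih_Q t) (Q_ih t) uQ J1_unit uX.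
by rewrite -pencil_coupled_tuple => /mulmx1_unit[].
Qed.

(** The Fock-space tuple is 0 at the isolated vertex and contributes [r(0)] there, which the value
    at [X] replaces. *)
Lemma direct_sum_eval t X :
  Q t \in unitmx -> des_dom r n X ->
  des_eval r _ (coupled_tuple t X 0) =
  des_eval r _ (fock_tuple n M t) + il *m (des_eval r n X - des_val0 r *t 1%:M) *m il^T.
Proof.
move=> uQ [sX uX].
have h := coupled0_inv eh ih_ih (ih_Q t) (Q_ih t) uQ J1_unit uX.
rewrite -pencil_coupled_tuple in h; have [u _] := mulmx1_unit h; rewrite !des_evalE des_val0E.
have -> : invmx (pencil J Am (coupled_tuple t X 0)) = invmx (Q t) + ih *m (invmx (J1 -
    lin_part X) - invmx J1) *m ih^T.
  by rewrite -[LHS]mulmx1 -h mulKmx.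
rewrite mulmxDr mulmxDl addrA; congr (_ + _).
rewrite (mulmxA _ _ ih^T) (mulmxA _ ih) C_ih -!(mulmxA _ ih^T) ihT_C.
by rewrite opprD addrACA subrr add0r -mulmxBl -mulmxBr !mulmxA.
Qed.

Lemma direct_sum_posdef t X :
  posdef (des_val0 r) -> Q t \in unitmx -> des_dom r n X ->
  posdef (des_eval r _ (fock_tuple n M t)) -> posdef (des_eval r n X) ->
  posdef (des_eval r _ (coupled_tuple t X 0)).
Proof.
move=> hpos uQ dX pY pX; rewrite direct_sum_eval //; apply: posdef_dsum => //.
- exact: il_il.
- rewrite des_evalE des_val0E mulmxDr mulmxDl; congr (_ + _).
    by rewrite trmx_tens trmx1 !tensmx_mul !mulmx1 !mul1mx.
  rewrite !mulmxA ilT_CT -(mulmxA _ ih^T) (corner_invl (ih_Q t) uQ J1_unit).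
  by rewrite -!mulmxA ihT_C.
- by rewrite trmx_tens trmx1; case: hpos => ->.
Qed.

End Couple.
End Lim.

(** The resolvent identity, once from the left and once from the right: in the result the resolvent
    occurs only inside [L S L], so a bound on this product bounds it. *)
Lemma resolvent_second (R : comUnitRingType) q (J' L : 'M[R]_q) :
  J' \in unitmx -> J' - L \in unitmx ->
  invmx (J' - L) = invmx J' + invmx J' *m L *m invmx J' +
    invmx J' *m (L *m invmx (J' - L) *m L) *m invmx J'.
Proof.
move=> uJ uX; set S := invmx (J' - L).
have e1 : S = invmx J' + invmx J' *m L *m S.
  have h : (J' - L) *m S = 1%:M by rewrite mulmxV.
  by rewrite -[invmx J' in X in _ = X + _]mulmx1 -h mulmxBl mulmxBr mulKmx // mulmxA subrK.
have e2 : S = invmx J' + S *m L *m invmx J'.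
  have h : S *m (J' - L) = 1%:M by rewrite mulVmx.
  by rewrite -[invmx J' in X in _ = X + _]mul1mx -h mulmxBr mulmxBl mulmxK // subrK.
by rewrite {1}e1 {1}e2 mulmxDr addrA !mulmxA.
Qed.

Section Lim.
Variables (R : realType) (g d l : nat) (r : descriptor R g d l).
Local Notation J := (desJ r).
Local Notation Am := (desA r).
Local Notation C := (desC r).
Local Notation D := (desD r).

Section Bound.
Variables (n M : nat) (t : R).
Local Notation Ni := (none_emb R g n M).
Local Notation Ne := (@word_emb R g n M [::]).
Local Notation ih := ((1%:M : 'M[R]_d) *t Ni).
Local Notation eh := ((1%:M : 'M[R]_d) *t Ne).
Local Notation il := ((1%:M : 'M[R]_l) *t Ni).
Local Notation J1 := (J *t (1%:M : 'M[R]_n)).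
Local Notation Q := (pencil J Am (fock_tuple n M t)).
Local Notation Pil := (1%:M - il *m il^T).
Local Notation ctup := (coupled_tuple M t).

Variable k : 'M[R]_(d * n, l * fock_dim g n M).
Hypothesis uQ : Q \in unitmx.
Hypothesis kc : k *m ((C *t 1%:M)^T *m invmx Q *m eh) = 1%:M.

(** [Pil] discards the isolated vertex, where alone the value at the direct sum differs from that at
    the Fock-space tuple; the Schur quantity thus becomes a difference of two values of [r]. *)
Lemma delta_eq X u : des_dom r n X ->
  (C *t 1%:M)^T *m ((1%:M - ih *m ih^T) *m (invmx (coupled Q (lin_part r X) ih eh u) - invmx Q)
     *m (1%:M - ih *m ih^T)) *m (C *t 1%:M) =
  Pil *m (des_eval r _ (ctup X u) - des_eval r _ (ctup X 0)) *m Pil.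
Proof.
move=> dX; rewrite direct_sum_eval //.
have Pil0 : Pil *m il = 0 by rewrite mulmxBl mul1mx -mulmxA il_il mulmx1 subrr.
have a1 : Pil *m (C *t 1%:M)^T = (C *t 1%:M)^T *m (1%:M - ih *m ih^T).
  by rewrite mulmxBl mul1mx mulmxBr mulmx1 mulmxA C_ih -!mulmxA ilT_CT.
have a2 : (C *t 1%:M) *m Pil = (1%:M - ih *m ih^T) *m (C *t 1%:M).
  have sym p q (U : 'M[R]_(p, q)) : (1%:M - U *m U^T)^T = 1%:M - U *m U^T.
    by rewrite linearB /= trmx1 trmx_mul trmxK.
  by apply: trmx_inj; rewrite !trmx_mul !sym a1.
rewrite opprD addrA (mulmxBr Pil) (mulmxA Pil) (mulmxA Pil) Pil0 !mul0mx subr0.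
have -> : des_eval r _ (ctup X u) - des_eval r _ (fock_tuple n M t) =
    (C *t 1%:M)^T *m (invmx (coupled Q (lin_part r X) ih eh u) - invmx Q) *m (C *t 1%:M).
  by rewrite !des_evalE pencil_coupled_tuple opprD addrACA subrr add0r -mulmxBl -mulmxBr.
by rewrite !mulmxA a1 -!mulmxA a2.
Qed.

(** Two values within [eta] of [Lam] differ by at most [2 * eta], which makes [Theta] small enough
    for [schur_bound]. *)
Lemma coupling_bound X u eta Lam :
  let K := l1 k * (l1 Pil * (2 * eta) * l1 Pil) * l1 k in
  K * (l1 (eh^T *m invmx Q *m eh) + 1) <= 2^-1 ->
  des_dom r n X -> des_pencil r (ctup X u) \in unitmx ->
  l1 (des_eval r _ (ctup X u) - Lam) <= eta ->
  l1 (des_eval r _ (ctup X 0) - Lam) <= eta ->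
  l1 (u ^+ 2 *: (lin_part r X *m invmx (J1 - lin_part r X) *m lin_part r X)) <= 1.
Proof.
move=> K hK dX uZ h1 h2; have [sX uX] := dX.
have uP : coupled Q (lin_part r X) ih eh u \in unitmx by rewrite -pencil_coupled_tuple.
have := @schur_bound _ _ _ Q J1 (lin_part r X) ih eh (ih_ih _ _ _ _ _) (ih_eh _ _ _ _ _)
    (ih_Q _ _ _ _) (Q_ih _ _ _ _) uQ (J1_unit r n) uX _ _ k u (Q_sym _ _ _ _) kc uP; apply.
rewrite delta_eq //; set Theta := k *m _ *m _.
apply: le_trans hK; rewrite ler_wpM2r ?addr_ge0 ?l1_ge0 //.
have hd : l1 (des_eval r _ (ctup X u) - des_eval r _ (ctup X 0)) <= 2 * eta.
  rewrite -(subrKA Lam); apply: le_trans (l1D _ _) _; rewrite -[Lam - _]opprB l1N.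
  by rewrite mulr_natl mulr2n; apply: lerD; [exact: h1 | exact: h2].
rewrite /Theta (le_trans (l1M _ _)) // l1_tr ler_wpM2r ?l1_ge0 //.
rewrite (le_trans (l1M _ _)) // ler_wpM2l ?l1_ge0 //.
rewrite (le_trans (l1M _ _)) // ler_wpM2r ?l1_ge0 //.
by rewrite (le_trans (l1M _ _)) // ler_wpM2l ?l1_ge0.
Qed.

End Bound.
End Lim.

(** * Exclusion of hidden singularities from the positivity set *)

Section Lim.
Variables (R : realType) (g d l : nat) (r : descriptor R g d l).
Local Notation J := (desJ r).
Local Notation Am := (desA r).
Local Notation C := (desC r).
Local Notation D := (desD r).

Lemma fock_tuple_exists n : minimal r -> posdef (des_val0 r) -> exists M t,
  [/\ pencil J Am (fock_tuple n M t) \in unitmx,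
      posdef (des_eval r _ (fock_tuple n M t)) &
      exists k : 'M[R]_(d * n, l * fock_dim g n M),
        k *m ((C *t 1%:M)^T *m invmx (pencil J Am (fock_tuple n M t)) *m
          (1%:M *t word_emb R n M [::])) = 1%:M].
Proof.
move=> hmin hpos; have [M sk] := fock_left_inverse n hmin; exists M.
have [sQ lQ] := lim0_fock_tuple n M Am (desJ_unit r).
have [e e0 he] := posdef_open (posdef_tens1 (fock_dim g n M) hpos).
have lE : lim0 (fun t => des_eval r _ (fock_tuple n M t)) (des_val0 r *t 1%:M).
  rewrite des_val0E; have [_ ->] := tensmx_inv (fock_dim g n M) (desJ_unit r).
  have lC := lim0_cst (C *t (1%:M : 'M[R]_(fock_dim g n M))).
  have lCT := lim0_cst (C *t (1%:M : 'M[R]_(fock_dim g n M)))^T.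
  apply: lim0_eq (lim0D (lim0_cst (D *t 1%:M)) (lim0M (lim0M lCT lQ) lC)).
  by exists 1 => // t _ _; rewrite des_evalE.
have [t _ [[ht1 ht2] ht3]] := small_ex (small_and (small_and sk sQ) (lim0_small e0 lE)).
exists t; split=> //; apply: he => //.
by apply: des_eval_sym => //; exact: fock_tuple_sym.
Qed.

Lemma pencil_scale n (X : mxtuple R g n) s :
  des_pencil r (fun j => s *: X j) = J *t 1%:M - s *: lin_part r X.
Proof.
rewrite /des_pencil /lin_part scaler_sumr; congr (_ - _).
by apply: eq_bigr => j _; rewrite tensmxZr.
Qed.

Lemma symtuple_scale n (X : mxtuple R g n) s : symtuple X -> symtuple (fun j => s *: X j).
Proof. by move=> h j; rewrite linearZ /= h. Qed.

(** A kernel vector of the pencil at [X], placed at the isolated vertex, is a kernel vector at the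
    direct sum. *)
Lemma direct_sum_singular n M t (X : mxtuple R g n) :
  symtuple X -> des_dom r _ (coupled_tuple M t X 0) -> des_dom r n X.
Proof.
move=> sX [_ u]; split => //; apply: unitmx_inj => x hx.
pose ih := (1%:M : 'M[R]_d) *t none_emb R g n M.
have : ih *m x = 0.
  rewrite -[LHS](mulKmx u) [X in invmx _ *m X](_ : _ = 0) ?mulmx0 //.
  rewrite [des_pencil _ _]pencil_coupled_tuple /coupled scale0r subr0 mulmxBl !mulmxA Q_ih.
  rewrite -(mulmxA _ ih^T) ih_ih mulmx1 -mulmxBl -mulmxBr -mulmxA.
  by rewrite [(_ - _) *m x]hx mulmx0.
by move=> /(congr1 (mulmx ih^T)); rewrite mulmxA ih_ih mul1mx mulmx0.
Qed.

(* [X] is singular, but it is the midpoint of the regular points (1 +- u) X. *)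
Lemma direct_sum_posset n M t (X : mxtuple R g n) :
  (0 < n)%N ->
  posdef (des_val0 r) -> convex_set (posset r (fock_dim g n M)) ->
  pencil J Am (fock_tuple n M t) \in unitmx ->
  posdef (des_eval r _ (fock_tuple n M t)) ->
  posset r n X -> hidden_sing r n X ->
  posset r _ (coupled_tuple M t X 0).
Proof.
move=> n0 hpos hconv uQ pY [_ pX] hX; have [sX nX cX] := hX.
have nu : des_pencil r X \in unitmx = false.
  by apply/negP => u; apply: nX.
rewrite /des_value nu in pX; have [e e0 he] := posdef_open pX.
have [dl dl0 hdl] := hidden_sing_limit hX e0.
pose B := \sum_j l1 (X j).
have B0 : 0 <= B by apply: sumr_ge0 => j _; exact: l1_ge0.
have near s : `|s - 1| <= dl / (B + 1) -> forall j, l1 (s *: X j - X j) <= dl.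
  move=> hs j; have -> : s *: X j - X j = (s - 1) *: X j by rewrite scalerBl scale1r.
  have XB : l1 (X j) <= B by rewrite /B (bigD1 j) //= lerDl sumr_ge0 // => i _; exact: l1_ge0.
  rewrite l1Z (@le_trans _ _ (dl / (B + 1) * B)) //.
    by apply: ler_pM; rewrite ?l1_ge0.
  rewrite mulrAC ler_pdivrMr ?ltr_wpDl //; nra.
pose L := lin_part r X; pose J1 := J *t (1%:M : 'M[R]_n).
(* The determinants at [(1 + s) X] and [(1 - s) X]; at [s = -1] and [s = 1] respectively they equal
   [\det J1], so neither polynomial is 0. *)
pose pa := det_line (J1 - L) (- L); pose pb := det_line (J1 - L) L.
have dJ : \det J1 != 0 by rewrite -unitfE -unitmxE J1_unit.
have pab : pa * pb != 0.
  apply: mulf_neq0.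
    apply/eqP => h; have := det_lineE (J1 - L) (- L) (-1).
    rewrite -/pa h horner0 scaleN1r opprK subrK => /esym/eqP.
    by rewrite (negbTE dJ).
  apply/eqP => h; have := det_lineE (J1 - L) L 1.
  by rewrite -/pb h horner0 scale1r subrK => /esym/eqP; rewrite (negbTE dJ).
have dB : 0 < dl / (B + 1) by rewrite divr_gt0 // ltr_wpDl.
have [u [u0 u1]] := poly_nonroot pab dB.
rewrite hornerM mulf_eq0 negb_or !det_lineE => /andP[da db].
have dom s : \det (J1 - s *: L) != 0 -> des_dom r n (fun j => s *: X j).
  move=> h; split; first exact: symtuple_scale.
  by rewrite pencil_scale unitmxE unitfE.
have d1 : des_dom r n (fun j => (1 + u) *: X j).
  by apply: dom; rewrite scalerDl scale1r opprD addrA -scalerN.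
have d2 : des_dom r n (fun j => (1 - u) *: X j).
  by apply: dom; rewrite scalerBl scale1r opprB addrA addrAC addrC addrA addrAC in db *.
have inP s : `|s - 1| <= dl / (B + 1) -> des_dom r n (fun j => s *: X j) ->
    posset r _ (coupled_tuple M t (fun j => s *: X j) 0).
  move=> hs ds; have dz := direct_sum_dom uQ ds; split; first by left.
  rewrite /des_value; case: dz => _ ->; apply: direct_sum_posdef => //.
  apply: he; last by apply: hdl => //; exact: near.
  by apply: des_eval_sym => //; case: ds.
have h1 : posset r _ (coupled_tuple M t (fun j => (1 + u) *: X j) 0).
  by apply: inP => //; rewrite addrC addKr ger0_norm ltW.
have h2 : posset r _ (coupled_tuple M t (fun j => (1 - u) *: X j) 0).
  by apply: inP => //; rewrite addrAC subrr sub0r normrN ger0_norm ltW.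
have i0 : 0 <= 2^-1 :> R by rewrite invr_ge0.
have i1 : 2^-1 <= 1 :> R by lra.
(* Both points share the Fock-space block, so their midpoint keeps it and averages [(1 + u) X] and
   [(1 - u) X] to [X]. *)
have := hconv _ _ (Itv01 i0 i1) (mem_set h1) (mem_set h2).
move/set_mem; congr (posset r _ _); apply/funext => j.
rewrite [LHS](_ : _ = 2^-1 *: coupled_tuple M t (fun j => (1 + u) *: X j) 0 j +
  (1 - 2^-1) *: coupled_tuple M t (fun j => (1 - u) *: X j) 0 j); last by [].
rewrite /coupled_tuple !scale0r !addr0 -!scalemxAr -!scalemxAl !scalerDr !scalerA addrACA
    -!scalerDl.
have -> : 2^-1 * (1 + u) + (1 - 2^-1) * (1 - u) = 1 by field.
have -> : 2^-1 + (1 - 2^-1) = 1 :> R by lra.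
by rewrite !scale1r.
Qed.

End Lim.

Section Lim.
Variables (R : realType) (g d l : nat) (r : descriptor R g d l).
Local Notation J := (desJ r).
Local Notation Am := (desA r).
Local Notation C := (desC r).
Local Notation D := (desD r).

Lemma lin_part_scale n (X : mxtuple R g n) s : lin_part r (fun j => s *: X j) = s *: lin_part
    r X.
Proof. by rewrite /lin_part scaler_sumr; apply: eq_bigr => j _; rewrite tensmxZr. Qed.

(* [P(s chi) x = (1 - s) J x] on the kernel of [P(chi)], so a bound on the
   resolvent for a single [s] close to 1 kills the kernel. *)
Lemma des_dom_of_resolvent_bound n (X : mxtuple R g n) (B s : R) :
  symtuple X -> s <= 1 ->
  J *t 1%:M - s *: lin_part r X \in unitmx ->
  l1 (invmx (J *t 1%:M - s *: lin_part r X)) <= B ->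
  (1 - s) * (B * l1 (J *t (1%:M : 'M[R]_n))) <= 2^-1 ->
  des_dom r n X.
Proof.
move=> sX s1 us hB hs; split=> //; apply: unitmx_inj => x hx.
set S := invmx _ in hB; pose J1 := J *t (1%:M : 'M[R]_n).
have Lx : lin_part r X *m x = J1 *m x.
  by apply/eqP; rewrite eq_sym -subr_eq0 -mulmxBl; apply/eqP.
have ex : x = (1 - s) *: (S *m (J1 *m x)).
  rewrite scalemxAr -[LHS](mulKmx us); congr (S *m _).
  by rewrite mulmxBl -scalemxAl Lx scalerBl scale1r.
apply: l1_eq0.
have : l1 x <= 2^-1 * l1 x.
  rewrite {1}ex l1Z ger0_norm ?subr_ge0 //.
  apply: (@le_trans _ _ ((1 - s) * (B * l1 J1) * l1 x)).
    rewrite -mulrA ler_wpM2l ?subr_ge0 // mulmxA (le_trans (l1M _ _)) //.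
    rewrite ler_wpM2r ?l1_ge0 // (le_trans (l1M _ _)) //.
    by rewrite ler_wpM2r ?l1_ge0.
  by rewrite ler_wpM2r ?l1_ge0.
lra.
Qed.

Lemma coupled_tuple_close n M t (X : mxtuple R g n) : exists2 B, 0 <= B &
  forall s u e, 0 <= s -> s <= 1 -> 1 - s <= e -> 0 <= u -> u <= e ->
  forall j, l1 (coupled_tuple M t (fun j => s *: X j) u j - coupled_tuple M t X 0 j) <= e * B.
Proof.
pose W j := none_emb R g n M *m X j *m (none_emb R g n M)^T.
pose V j := none_emb R g n M *m X j *m (word_emb R n M [::])^T + word_emb R n M [::] *m X j
    *m (none_emb R g n M)^T.
pose B := \sum_j (l1 (W j) + l1 (V j)).
exists B; first by apply: sumr_ge0 => j _; rewrite addr_ge0 ?l1_ge0.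
move=> s u e s0 s1 se u0 ue j.
have -> : coupled_tuple M t (fun j => s *: X j) u j - coupled_tuple M t X 0 j = (s - 1) *: W
    j + (u * s) *: V j.
  rewrite /coupled_tuple scale0r addr0 -!scalemxAr -!scalemxAl -!scalerDr scalerA -/(W j)
      -/(V j).
  by rewrite opprD addrACA subrr addr0 addrAC scalerBl scale1r.
have jB : l1 (W j) + l1 (V j) <= B.
  by rewrite /B (bigD1 j) //= lerDl sumr_ge0 // => i _; rewrite addr_ge0 ?l1_ge0.
have e0 : 0 <= e by apply: le_trans ue.
rewrite (le_trans (l1D _ _)) // !l1Z; apply: le_trans (ler_wpM2l e0 jB).
rewrite mulrDr lerD // ler_wpM2r ?l1_ge0 //.
  by rewrite distrC ger0_norm // subr_ge0.
by rewrite ger0_norm ?mulr_ge0 // (le_trans _ ue) // ler_piMr.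
Qed.

(** The constants come in the order [eta], [sg], [BS], [rho], [s], [u]. Since [u] stays above
    [sg / 2] however close [s] is to 1, the bound [BS] on the resolvent at [s X] is fixed before [s]
    is chosen. *)
Lemma posset_hidden_sing n (X : mxtuple R g n) :
  (0 < n)%N -> minimal r -> posdef (des_val0 r) ->
  (forall n, (0 < n)%N -> convex_set (posset r n)) ->
  posset r n X -> hidden_sing r n X -> False.
Proof.
move=> n0 hmin hpos hconv pX hX; have [sX nX _] := hX; apply: (nX).
have [M [t [uQ pY [k kc]]]] := fock_tuple_exists n hmin hpos.
have N0 : (0 < fock_dim g n M)%N.
  by rewrite /fock_dim; apply/card_gt0P; exists (None, Ordinal n0).
have pZ := direct_sum_posset n0 hpos (hconv _ N0) uQ pY pX hX.
(* Convexity puts the direct sum in the limit domain. If it is regular then so is [X]; otherwise it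
   is a hidden singularity and has a limit. *)
case: (pZ) => -[/(direct_sum_singular sX) // |hZ] _.
set J1 := J *t (1%:M : 'M[R]_n); pose L := lin_part r X.
pose ih := (1%:M : 'M[R]_d) *t none_emb R g n M.
pose eh := (1%:M : 'M[R]_d) *t @word_emb R g n M [::].
pose il := (1%:M : 'M[R]_l) *t none_emb R g n M.
pose pi_ := l1 (1%:M - il *m il^T).
pose ka := l1 (eh^T *m invmx (pencil J Am (fock_tuple n M t)) *m eh).
pose K := l1 k * (pi_ * pi_) * l1 k.
have K0 : 0 <= K by rewrite /K /pi_ !mulr_ge0 ?l1_ge0.
have ka0 : 0 <= ka by exact: l1_ge0.
pose eta := (4 * (K + 1) * (ka + 1))^-1.
have eta0 : 0 < eta by rewrite invr_gt0 !mulr_gt0 // ltr_wpDl.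
have hK : l1 k * (pi_ * (2 * eta) * pi_) * l1 k * (ka + 1) <= 2^-1.
  have -> : l1 k * (pi_ * (2 * eta) * pi_) * l1 k * (ka + 1) = 2^-1 * (K / (K + 1)).
    by rewrite /eta /K; field; rewrite -/K !lt0r_neq0 // ltr_wpDl.
  by rewrite ler_piMr ?invr_ge0 // ler_pdivrMr ?ltr_wpDl // mul1r lerDl.
have [dl dl0 hdl] := hidden_sing_limit hZ eta0.
have [B B0 hB] := coupled_tuple_close M t X.
have dB : 0 < dl / (B + 1) by rewrite divr_gt0 // ltr_wpDl.
pose sg := Num.min 2^-1 (dl / (B + 1)).
have sg0 : 0 < sg by rewrite lt_min dB invr_gt0 ltr0n.
have sg1 : sg <= 2^-1 by rewrite ge_min lexx.
have sgB : sg * B <= dl.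
  have : sg <= dl / (B + 1) by rewrite ge_min lexx orbT.
  by rewrite ler_pdivlMr ?ltr_wpDl //; nra.
(* As [u] will exceed [sg / 2], [BT] dominates [u ^- 2]. *)
pose BT := 4 / sg ^+ 2; pose j1 := l1 (invmx J1).
have j10 : 0 <= j1 by exact: l1_ge0.
have BT0 : 0 <= BT by rewrite divr_ge0 // exprn_ge0 // ltW.
(* The three terms of [resolvent_second], with [BT] bounding the norm of [L S L]. *)
pose BS := j1 + j1 * l1 L * j1 + j1 * BT * j1.
have BS0 : 0 <= BS.
  by apply: addr_ge0; [apply: addr_ge0 => // |]; apply: mulr_ge0 => //; apply: mulr_ge0 =>
      //; exact: l1_ge0.
have BJ0 : 0 <= BS * l1 J1 by rewrite mulr_ge0 ?l1_ge0.
pose rho := Num.min sg (2 * (BS * l1 J1 + 1))^-1.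
have rho0 : 0 < rho by rewrite lt_min sg0 invr_gt0 mulr_gt0 // ltr_wpDl.
have rho1 : rho <= sg by rewrite ge_min lexx.
have rho2 : rho * (BS * l1 J1) <= 2^-1.
  have : rho <= (2 * (BS * l1 J1 + 1))^-1 by rewrite ge_min lexx orbT.
  rewrite -[X in _ <= X -> _]mul1r ler_pdivlMr ?mulr_gt0 ?ltr_wpDl //; nra.
have p1 : det_line J1 (- L) != 0.
  apply/eqP => h; have := det_lineE J1 (- L) 0; rewrite h horner0 scale0r addr0 => /esym/eqP.
  by apply/negP; rewrite -unitfE -unitmxE J1_unit.
have [|s [s1 s2]] := poly_nonroot (a := 1 - rho) (b := 1) p1; first by rewrite ltrBlDr ltrDl.
rewrite det_lineE scalerN -unitfE -unitmxE => us.
have s3 : 1 - s <= rho by rewrite lerBlDl -lerBlDr ltW.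
have s4 : 1 - s <= sg by apply: le_trans rho1.
have s0 : 0 <= s.
  by rewrite -(subKr 1 s) subr_ge0 (le_trans s4) // (le_trans sg1) // invf_le1 ?ltr0n // ler1n.
pose Xs : mxtuple R g n := fun j => s *: X j.
have dXs : des_dom r n Xs.
  by split; [exact: symtuple_scale | rewrite pencil_scale].
have dZs := direct_sum_dom uQ dXs.
pose P0 := pencil J Am (coupled_tuple M t Xs 0).
pose E1 := ih *m lin_part r Xs *m eh^T + eh *m lin_part r Xs *m ih^T.
(* At [u = 0] this is the pencil of a regular direct sum, so some [u] between [sg / 2] and [sg] is
   regular too. *)
have p2 : det_line P0 (- E1) != 0.
  apply/eqP => h; have := det_lineE P0 (- E1) 0; rewrite h horner0 scale0r addr0 => /esym/eqP.
  by apply/negP; rewrite -unitfE -unitmxE; case: dZs.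
have [|u [u1 u2]] := poly_nonroot (a := sg / 2) (b := sg) p2; first by rewrite ltr_pdivrMr //
    ltr_pMr // (ltr_nat R 1).
have u0 : 0 < u by apply: lt_trans u1; rewrite divr_gt0.
rewrite det_lineE scalerN -unitfE -unitmxE => uZ.
have uZ' : des_pencil r (coupled_tuple M t Xs u) \in unitmx.
  move: uZ; rewrite /P0 [des_pencil _ _]pencil_coupled_tuple pencil_coupled_tuple /coupled.
  by rewrite scale0r subr0.
have dZ' : des_dom r _ (coupled_tuple M t Xs u).
  by split=> //; apply: coupled_tuple_sym; exact: symtuple_scale.
have c1 : l1 (des_eval r _ (coupled_tuple M t Xs u) - lim (des_eval r _ @ des_approach r
    (coupled_tuple M t X 0))%classic) <= eta.
  by apply: hdl => // j; apply: le_trans (hB s u sg s0 (ltW s2) s4 (ltW u0) (ltW u2) j) _.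
have c2 : l1 (des_eval r _ (coupled_tuple M t Xs 0) - lim (des_eval r _ @ des_approach r
    (coupled_tuple M t X 0))%classic) <= eta.
  by apply: hdl => // j; apply: le_trans (hB s 0 sg s0 (ltW s2) s4 (lexx 0) (ltW sg0) j) _.
have := coupling_bound uQ kc hK dXs uZ' c1 c2.
set T := lin_part r Xs *m _ *m _; rewrite l1Z ger0_norm ?exprn_ge0 ?(ltW u0) // => hT.
have T0 := l1_ge0 T.
have TB : l1 T <= BT.
  rewrite /BT ler_pdivlMr ?exprn_gt0 //.
  have su : sg ^+ 2 <= 4 * u ^+ 2.
    have -> : 4 = 2 ^+ 2 :> R by rewrite -natrX.
    rewrite -exprMn lerXn2r ?nnegrE ?(ltW sg0) ?mulr_ge0 ?(ltW u0) //.
    by rewrite mulrC -ler_pdivrMr // ltW.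
  apply: le_trans (ler_wpM2l T0 su) _.
  by rewrite mulrCA ler_piMr // mulrC.
have LL : l1 (lin_part r Xs) <= l1 L.
  by rewrite lin_part_scale l1Z ger0_norm // ler_piMl ?l1_ge0 // ltW.
apply: (@des_dom_of_resolvent_bound n X BS s) => //; first exact: ltW.
  rewrite -/J1 -lin_part_scale -/Xs resolvent_second ?J1_unit //; last first.
    by rewrite lin_part_scale.
  have m3 (a b c : 'M[R]_(d * n)) x : l1 b <= x -> l1 (a *m b *m c) <= l1 a * x * l1 c.
    move=> bx; rewrite (le_trans (l1M _ _)) // ler_wpM2r ?l1_ge0 //.
    by rewrite (le_trans (l1M _ _)) // ler_wpM2l ?l1_ge0.
  rewrite (le_trans (l1D _ _)) // /BS lerD ?m3 //.
  by rewrite (le_trans (l1D _ _)) // lerD // m3.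
by apply: le_trans rho2; rewrite ler_wpM2r.
Qed.

End Lim.

Theorem theorem1p5 (R : realType) (g d l : nat) (r : descriptor R g d l)
    (hg : (0 < g)%N) (hmin : minimal r) (hpos : posdef (des_val0 r)) :
  ((forall n : nat, (0 < n)%N -> convex_set (posset r n)) ->
   forall n : nat, (0 < n)%N ->
     posset r n `&` hidden_sing r n = set0)
  /\
  (forall n : nat, (0 < n)%N ->
     domalg r n `&` hidden_sing r n = set0).
Proof.
split=> [hconv n n0|n n0]; rewrite -subset0 => X [].
  by move=> /(posset_hidden_sing n0 hmin hpos hconv) h /h.
by move=> /(domalg_des_dom hmin) dX [_ /(_ dX)].
Qed.
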